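(* In the canonical model described in the context, let $C=\mathrm{diag}(c_1,\dots,c_l)$ with $c_i\ge1$, and consider the estimators $$\hat\theta_{\nu,C}=\left(I_l-\frac{\nu}{\nu+1+W}C^{-1}\right)V,\qquad \hat\sigma^2_{\nu,C}=\left(1-\frac{\nu}{\nu+1+W}\right)\frac{S}{n-k},$$ where $W=\{V'C^{-1}D^{-1}V+\|V_*\|^2/\gamma\}/S$ (the term $\|V_*\|^2/\gamma$ being omitted when $m\ge k$). If $\gamma\ge1$ and $0<\nu\le\min(\nu_1,\nu_2,\nu_3)$, where $$\nu_1=4\,\frac{\sum(d_i/c_i)-2\max(d_i/c_i)+m/(n-k)}{2\max(d_i/c_i)(n-k+2)+m},$$ $$\nu_2=\frac{4\{\sum(d_i/c_i)-\max(d_i/c_i)\}+2m/(n-k)}{(n-k-2)\max(d_i/c_i)+m},\qquad \nu_3=\frac4m\sum\frac{d_i}{c_i}$$ (sums and maxima over $1\le i\le l$), then the pair $(\hat\theta_{\nu,C},\hat\sigma^2_{\nu,C})$ dominates the pair of UMVU estimators $(V,\,S/(n-k))$ of $(\theta,\sigma^2)$ under the loss $$\frac12\left\{\frac{\|\hat\theta-\theta\|^2}{\sigma^2}+m\left(\frac{\hat\sigma^2}{\sigma^2}-\log\frac{\hat\sigma^2}{\sigma^2}-1\right)\right\}.$$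
   Context: Canonical model. Let $n>k\ge1$ and $m\ge1$ be integers and $l=\min(k,m)$. One observes independent $$V\sim N_l(\theta,\sigma^2D),\qquad V_*\sim N_{k-l}(\mu,\sigma^2I_{k-l}),\qquad S/\sigma^2\sim\chi^2_{n-k},$$ where $\theta\in\mathbb{R}^l$, $\mu\in\mathbb{R}^{k-l}$ and $\sigma^2>0$ are unknown, and $D=\mathrm{diag}(d_1,\dots,d_l)$ is known with $d_1\ge\dots\ge d_l>0$. When $m\ge k$ (so $l=k$), $V_*$ and $\mu$ are empty. A prime denotes transpose. An estimator dominates another under a loss if its risk (expected loss) is less than or equal to that of the other for all parameter values $(\theta,\mu,\sigma^2)$, with strict inequality for some parameter value. The displayed loss equals the divergence $D_1$, i.e. $\int\hat p\log(\hat p/p)\,d\tilde y$, from the plug-in normal density $\hat p$ of $N_m(Q\hat\theta,\hat\sigma^2I_m)$ to the true density $p$ of $N_m(Q\theta,\sigma^2I_m)$ of a future observation, where $Q$ is an $m\times l$ matrix with $Q'Q=I_l$. The estimators $(\hat\theta_{\nu,C},\hat\sigma^2_{\nu,C})$ are generalized Bayes with $\nu=(k+2a+2)/(n-k)$, where $a>-k/2-1$ is a prior hyperparameter, so any $\nu>0$ is possible. *)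

(* Defs.v *)
From mathcomp Require Export all_boot all_order all_algebra.
From mathcomp Require Export all_classical all_reals all_analysis.

Set Implicit Arguments.
Unset Strict Implicit.
Unset Printing Implicit Defensive.

Import Order.TTheory GRing.Theory Num.Theory.
Import numFieldNormedType.Exports.

Local Open Scope classical_set_scope.
Local Open Scope ring_scope.

(* The norm of the library on matrices is the sup norm; [sqnorm x] is the
   squared Euclidean norm. *)
Definition sqnorm (R : realType) (n : nat) (x : 'cV[R]_n) : R :=
  \sum_i x i 0 ^+ 2.

(* Random vectors take their values in [n.-tuple R], which carries the product
   sigma-algebra; the algebra is done on column vectors. *)
Definition colv (R : realType) (n : nat) (x : n.-tuple R) : 'cV[R]_n :=
  \col_i tnth x i.

(* Lebesgue integral over R^n of a nonnegative function, as an iterated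
   integral (Tonelli). R^0 is a point of mass 1. *)
Fixpoint lebesgue_iint (R : realType) (n : nat) :
    (n.-tuple R -> \bar R) -> \bar R :=
  match n with
  | 0 => fun f => f [tuple]
  | n'.+1 => fun f => (\int[lebesgue_measure]_(x in [set: R])
                 lebesgue_iint (fun t : n'.-tuple R => f [tuple of x :: t]))%E
  end.

Definition mvnormal_pdf (R : realType) (n : nat) (mu : 'cV[R]_n)
    (Sigma : 'M[R]_n) (x : n.-tuple R) : R :=
  (Num.sqrt ((2 * pi) ^+ n * \det Sigma))^-1 *
  expR (- ((colv x - mu)^T *m invmx Sigma *m (colv x - mu)) 0 0 / 2).

(* The normal distribution N_n(mu, Sigma), for Sigma positive definite. *)
Definition mvnormal (R : realType) (n : nat) (mu : 'cV[R]_n) (Sigma : 'M[R]_n)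
    (A : set (n.-tuple R)) : \bar R :=
  lebesgue_iint (fun x => (\1_A x * mvnormal_pdf mu Sigma x)%:E).

(* The chi-square distribution with N degrees of freedom, i.e. the law of the
   sum of the squares of N independent standard normal variables. *)
Definition chi_square (R : realType) (N : nat) (A : set R) : \bar R :=
  mvnormal 0 1%:M [set z : N.-tuple R | A (sqnorm (colv z))].

Definition has_law (R : realType) d d' (T : measurableType d)
    (T' : measurableType d') (P : probability T R) (X : T -> T')
    (law : set T' -> \bar R) : Prop :=
  forall A : set T', measurable A -> P (X @^-1` A) = law A.

(* Since each of A1, A2, A3 may be the whole space, the product rule for triples
   also gives the product rule for pairs. *)
Definition independent3 (R : realType) d d1 d2 d3 (T : measurableType d)
    (T1 : measurableType d1) (T2 : measurableType d2) (T3 : measurableType d3)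
    (P : probability T R) (X1 : T -> T1) (X2 : T -> T2) (X3 : T -> T3) : Prop :=
  forall (A1 : set T1) (A2 : set T2) (A3 : set T3),
    measurable A1 -> measurable A2 -> measurable A3 ->
    P (X1 @^-1` A1 `&` X2 @^-1` A2 `&` X3 @^-1` A3) =
    (P (X1 @^-1` A1) * P (X2 @^-1` A2) * P (X3 @^-1` A3))%E.

(* Parameters: theta, mu and the variance sigma^2. *)
Definition param (R : realType) (l q : nat) : Type :=
  ('cV[R]_l * 'cV[R]_q * R)%type.

Definition param_ok (R : realType) (l q : nat) (p : param R l q) : Prop :=
  0 < p.2.

(* P is the distribution of the observations (V, Vs, S) at the parameter p, with
   N degrees of freedom for S. *)
Definition canonical_model (R : realType) d (T : measurableType d)
    (l q N : nat) (D : 'M[R]_l) (V : {mfun T >-> l.-tuple R})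
    (Vs : {mfun T >-> q.-tuple R}) (S : {mfun T >-> R})
    (p : param R l q) (P : probability T R) : Prop :=
  let: (theta, mu, sigma2) := p in
  [/\ has_law P V (mvnormal theta (sigma2 *: D)),
      has_law P Vs (mvnormal mu (sigma2 *: 1%:M)),
      has_law P (fun w => S w / sigma2) (@chi_square R N) &
      independent3 P V Vs S].

(* An estimator of (theta, sigma^2), as a function of the data (V, Vs, S). *)
Definition estimator (R : realType) (l q : nat) : Type :=
  'cV[R]_l -> 'cV[R]_q -> R -> 'cV[R]_l * R.

Definition loss (R : realType) (l q m : nat) (p : param R l q)
    (a : 'cV[R]_l * R) : R :=
  let: (theta, mu, sigma2) := p in
  2^-1 * (sqnorm (a.1 - theta) / sigma2
          + m%:R * (a.2 / sigma2 - ln (a.2 / sigma2) - 1)).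

Definition risk (R : realType) d (T : measurableType d) (l q m : nat)
    (P : param R l q -> probability T R) (V : T -> l.-tuple R)
    (Vs : T -> q.-tuple R) (S : T -> R) (delta : estimator R l q)
    (p : param R l q) : \bar R :=
  'E_(P p)[fun w => loss m p (delta (colv (V w)) (colv (Vs w)) (S w))].

Definition dominates (R : realType) (l q : nat)
    (risk : estimator R l q -> param R l q -> \bar R)
    (delta delta0 : estimator R l q) : Prop :=
  (forall p, param_ok p -> (risk delta p <= risk delta0 p)%E) /\
  (exists2 p, param_ok p & (risk delta p < risk delta0 p)%E).

Definition umvu (R : realType) (l q N : nat) : estimator R l q :=
  fun V Vs S => (V, S / N%:R).

(* When q = 0 the term in Vs is an empty sum. *)
Definition Wstat (R : realType) (l q : nat) (C D : 'M[R]_l) (gamma : R)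
    (V : 'cV[R]_l) (Vs : 'cV[R]_q) (S : R) : R :=
  ((V^T *m invmx C *m invmx D *m V) 0 0 + sqnorm Vs / gamma) / S.

Definition gbayes (R : realType) (l q N : nat) (C D : 'M[R]_l) (gamma nu : R) :
    estimator R l q :=
  fun V Vs S =>
    let phi := nu / (nu + 1 + Wstat C D gamma V Vs S) in
    ((1%:M - phi *: invmx C) *m V, (1 - phi) * (S / N%:R)).

(* Below r i = d_i / c_i > 0, so that the default value 0 of [max_of] is
   immaterial for l > 0. *)
Definition max_of (R : realType) (l : nat) (r : 'I_l -> R) : R :=
  \big[Num.max/0]_i r i.

Definition nu1 (R : realType) (l m N : nat) (r : 'I_l -> R) : R :=
  4 * ((\sum_i r i - 2 * max_of r + m%:R / N%:R)
       / (2 * max_of r * (N%:R + 2) + m%:R)).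

Definition nu2 (R : realType) (l m N : nat) (r : 'I_l -> R) : R :=
  (4 * (\sum_i r i - max_of r) + 2 * m%:R / N%:R)
  / ((N%:R - 2) * max_of r + m%:R).

Definition nu3 (R : realType) (l m : nat) (r : 'I_l -> R) : R :=
  4 / m%:R * \sum_i r i.

(* Main.v *)
(* Write phi = nu / (nu + 1 + W), r_i = d_i / c_i and N = n - k. Twice the loss
   difference is, when S > 0,
     - 2 phi (V - theta)' C^-1 V / sigma^2 + phi^2 V' C^-2 V / sigma^2
     - m phi S / (N sigma^2) - m ln (1 - phi).
   Stein's identity in each V_i removes theta from the first term. Realizing S as
   sigma^2 |z|^2 with z standard normal, Stein's identity in each z_j gives
   E[(S / sigma^2) g(S)] = E[N g(S) + 2 S g'(S)], which removes sigma^2 from the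
   next two. The result is the expectation of a function of W and
   A = V' C^-2 V / S, where 0 <= A <= (max r) W. Using
   - ln (1 - phi) < phi + phi^2 / (2 (1 - phi)), this function is bounded by one
   that is affine in A, and it is negative at A = 0 (by nu <= nu3) and at
   A = (max r) W (by nu <= nu1 and nu <= nu3). Hence the risk difference is
   negative at every parameter; the risk of the UMVU pair is finite because
   ln (|z|^2) is integrable. *)

From HB Require Import structures.
Require Import Defs.
From mathcomp Require Import measurable_realfun ring lra.

Set Implicit Arguments.
Unset Strict Implicit.
Unset Printing Implicit Defensive.

Import Order.TTheory GRing.Theory Num.Theory.
Import numFieldNormedType.Exports.

Local Open Scope classical_set_scope.
Local Open Scope ring_scope.

(** The obstacle is the point S = 0. The quotients W and A are singular there, division by 0 and
    [ln 0] return 0, and yet Stein's identity in z wants functions differentiable on all of R^N.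
    Hence three forms of the same factor phi: one cut off at S = 0 for the identity in V, where S is
    only a parameter; one with cleared denominators for the identity in z; and the plain quotient
    inside the logarithm, to which no identity is applied. They agree for z different from 0, that
    is, almost everywhere. On the abstract sample space only the law of the data is given, so
    expectations are moved to an explicit product space. The logarithm bound is sinh t > t at t = -
    ln (1 - phi). Put p = W / (nu + 1 + W). After a slight weakening and p^2 <= p, the value at A =
    (max r) W is bounded by an affine function of p: [nu3] settles p = 0 and [nu1] settles p = 1. *)

Lemma integrable_le_integrable d (T : measurableType d) (R : realType)
    (mu : {measure set T -> \bar R}) (f g : T -> R) :
  measurable_fun setT f -> (forall x, `|f x| <= g x) ->
  mu.-integrable setT (EFin \o g) -> mu.-integrable setT (EFin \o f).
Proof.
move=> mf fg; apply: le_integrable => //; first exact/measurable_EFinP.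
by move=> x _ /=; rewrite lee_fin (le_trans (fg x))// ler_norm.
Qed.

Lemma integrable_scale d (T : measurableType d) (R : realType)
    (mu : {measure set T -> \bar R}) (k : R) (f : T -> R) :
  mu.-integrable setT (EFin \o f) ->
  mu.-integrable setT (EFin \o (fun x => k * f x)).
Proof. by move=> intf; exact: (integrableZl measurableT k intf). Qed.

Lemma integrable_add d (T : measurableType d) (R : realType)
    (mu : {measure set T -> \bar R}) (f g : T -> R) :
  mu.-integrable setT (EFin \o f) -> mu.-integrable setT (EFin \o g) ->
  mu.-integrable setT (EFin \o (fun x => f x + g x)).
Proof. by move=> intf intg; exact: (integrableD measurableT intf intg). Qed.

Lemma integrable_sub d (T : measurableType d) (R : realType)
    (mu : {measure set T -> \bar R}) (f g : T -> R) :
  mu.-integrable setT (EFin \o f) -> mu.-integrable setT (EFin \o g) ->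
  mu.-integrable setT (EFin \o (fun x => f x - g x)).
Proof. by move=> intf intg; exact: (integrableB measurableT intf intg). Qed.

(** * Stein's identity for the univariate normal distribution *)

Section density.
Context (R : realType) (m s : R).
Local Notation mu := (@lebesgue_measure R).
Local Notation N := (normal_prob m s).

(** The change of variables goes through the Radon-Nikodym derivative, which is determined only
    almost everywhere. It is identified with the density because both have the same integral over
    every measurable set. *)
Lemma integral_normal_prob (f : R -> \bar R) : N.-integrable setT f ->
  (\int[N]_x f x = \int[mu]_x (f x * (normal_pdf m s x)%:E))%E.
Proof.
move=> intf; have mf := measurable_int _ intf.
rewrite -(Radon_Nikodym_change_of_variables (normal_prob_dominates m s))//=.
apply: ae_eq_integral => //.
- apply: emeasurable_funM => //; apply: (measurable_int mu).
  by apply: Radon_Nikodym_integrable; exact: normal_prob_dominates.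
- apply: emeasurable_funM => //; apply/measurable_EFinP.
  exact: measurable_normal_pdf.
- apply: ae_eqe_mul2l => /=.
  rewrite Radon_NikodymE//=; first exact: normal_prob_dominates.
  move=> abmu.
  case: cid => /= h [h1 h2 h3].
  apply: integral_ae_eq => //=.
  + by apply/measurable_EFinP; exact: measurable_normal_pdf.
  + by move=> E E01 mE; rewrite -h3.
Qed.

(** The previous formula presupposes integrability under the normal law, which is the point here. It
    is therefore applied to the truncations of |f| at n, which are bounded, and monotone convergence
    removes the truncation. *)
Lemma integrable_normal_prob (f : R -> R) : measurable_fun setT f ->
  mu.-integrable setT (fun x => (f x * normal_pdf m s x)%:E) ->
  N.-integrable setT (EFin \o f).
Proof.
move=> mf /integrableP[_ foo]; apply/integrableP; split.
  exact/measurable_EFinP.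
pose g (n : nat) (x : R) : \bar R := (Num.min `|f x| n%:R)%:E.
have mg n : measurable_fun setT (g n).
  by apply/measurable_EFinP/measurable_minr => //; exact: measurableT_comp.
have g0 n x : (0 <= g n x)%E by rewrite lee_fin le_min normr_ge0 ler0n.
have -> : (\int[N]_x `|(EFin \o f) x| = \int[N]_x limn (g ^~ x))%E.
  apply: eq_integral => x _; apply/esym/cvg_lim => //.
  apply/cvg_EFin; first by near=> n.
  apply: cvg_near_cst.
  exists (Num.truncn `|f x|).+1 => // n /= fn.
  rewrite /g /= min_l//; apply: ltW.
  apply: lt_le_trans (truncnS_gt _) _.
  by rewrite ler_nat.
rewrite monotone_convergence//; last first.
  move=> x _ a b ab; rewrite /g lee_fin le_min ge_min lexx /=.
  by rewrite ge_min ler_nat ab orbT.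
apply: le_lt_trans foo; apply: lime_le.
  apply: ereal_nondecreasing_is_cvgn => a b ab.
  apply: ge0_le_integral => //; [exact: mg|exact: mg|move=> x _].
  rewrite /g lee_fin le_min ge_min lexx /=.
  by rewrite ge_min ler_nat ab orbT.
apply: nearW => n.
rewrite integral_normal_prob; last first.
  apply: (@measurable_bounded_integrable _ _ _ N (fun x => Num.min `|f x| n%:R)) => //=.
  - by rewrite (_ : N setT = 1%E) ?ltry//; exact: probability_setT.
  - by have /measurable_EFinP := mg n.
  - exists n%:R; split; first exact: num_real.
    move=> K nK x _ /=; rewrite ger0_norm ?le_min ?normr_ge0//=.
    by rewrite ge_min (ltW nK) orbT.
apply: ge0_le_integral => //=.
- by move=> x _; rewrite mule_ge0// lee_fin normal_pdf_ge0.
- by apply: emeasurable_funM; [exact: mg|apply/measurable_EFinP; exact: measurable_normal_pdf].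
- apply/measurable_EFinP; apply: measurableT_comp => //.
  by apply: measurable_funM => //; exact: measurable_normal_pdf.
- move=> x _; rewrite lee_fin normrM [X in _ <= _ * X]ger0_norm ?normal_pdf_ge0//.
  by rewrite ler_wpM2r ?normal_pdf_ge0// ge_min lexx.
Unshelve. all: by end_near. Qed.

End density.

Lemma is_derive_continuous (R : realType) (f : R -> R) (x df : R) :
  is_derive x 1 f df -> {for x, continuous f}.
Proof. by case=> fx _; apply/differentiable_continuous/derivable1_diffP. Qed.

Lemma integral_derive_eq0 (R : realType) (F F' : R -> R) :
  (forall x : R, is_derive x 1 F (F' x)) -> continuous F' ->
  lebesgue_measure.-integrable setT (EFin \o F') ->
  F n%:R @[n --> \oo] --> 0 -> F (- n%:R) @[n --> \oo] --> 0 ->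
  (\int[lebesgue_measure]_x (F' x)%:E = 0)%E.
Proof.
move=> dF cF' iF' Fy FNy; set mu := lebesgue_measure.
have mF' : measurable_fun [set: R] F' by exact: continuous_measurable_fun.
(* The radius is [n.+1] because the fundamental theorem of calculus is used on a nondegenerate
   interval, also for [n = 0]. Dominated convergence with bound |F'| reaches the whole line. *)
pose I (n : nat) := `[- n.+1%:R, n.+1%:R]%classic : set R.
have [|||||_ _ H] := @dominated_convergence _ _ R mu setT measurableT
   (fun n => EFin \o (F' \_ (I n))) (EFin \o F') (abse \o (EFin \o F')).
- move=> n; apply/measurable_EFinP; apply/(measurable_restrictT _ _).1 => //.
  + exact: measurable_itv.
  + exact: measurable_funTS.
- exact/measurable_EFinP.
- apply: aeW => x _; apply/cvg_EFin; first by near=> n.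
  apply: cvg_near_cst; exists (Num.truncn `|x|) => // n /= xn.
  rewrite patchE mem_set// /I/= in_itv/= -ler_norml; apply: ltW.
  by apply: lt_le_trans (truncnS_gt _) _; rewrite ler_nat ltnS.
- exact: integrable_abse.
- apply: aeW => x n _ /=; rewrite patchE; case: ifPn => // _.
  by rewrite lee_fin normr0.
move: H; rewrite [X in X @ \oo](_ : _ = (fun n => (F n.+1%:R - F (- n.+1%:R))%:E)); last first.
  apply/funext => n /=.
  transitivity (\int[mu]_(x in I n) (F' x)%:E)%E.
    rewrite [RHS]integral_mkcond; apply: eq_integral => x _ /=.
    by rewrite !patchE; case: ifPn.
  rewrite (@continuous_FTC2 _ F' F)//.
  - by rewrite -subr_gt0 opprK addr_gt0 ?ltr0n.
  - exact: continuous_subspaceT.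
  - split.
    + by move=> x _; case: (dF x).
    + by apply: cvg_at_right_filter; exact: (is_derive_continuous (dF _)).
    + by apply: cvg_at_left_filter; exact: (is_derive_continuous (dF _)).
  - by move=> x _; rewrite derive1E; exact: derive_val.
move=> H; apply: (cvg_unique _ H) => //.
rewrite -[0%E]/(0%:E); apply/cvg_EFin; first by near=> n.
have -> : (0 : R) = 0 - 0 by rewrite subr0.
apply: cvgB.
  by move: Fy; rewrite -(cvg_shiftS (fun n => F n%:R)).
by move: FNy; rewrite -(cvg_shiftS (fun n => F (- n%:R))).
Unshelve. all: by end_near. Qed.

Section normal_stein.
Context (R : realType) (m s : R).
Hypothesis s0 : s != 0.
Local Notation N := (normal_prob m s).
Local Notation mu := (@lebesgue_measure R).

Lemma is_derive_normal_pdf (x : R) :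
  is_derive x 1 (normal_pdf m s) (- ((x - m) / s ^+ 2) * normal_pdf m s x).
Proof.
rewrite normal_pdfE//; apply: is_derive_eq.
rewrite /normal_fun/= /GRing.scale/=.
have s2 : s ^+ 2 != 0 by rewrite expf_neq0.
rewrite -mulr_natr; field.
by rewrite s0.
Qed.

(* Half of the Gaussian exponent absorbs the quadratic factor; the price is a
   larger standard deviation. *)
Lemma normal_pdf_sqr_le : exists2 C : R, 0 <= C & forall x,
  (1 + `|x|) ^+ 2 * normal_pdf m s x <= C * normal_pdf m (Num.sqrt 2 * s) x.
Proof.
have t0 : Num.sqrt 2 * s != 0 :> R by rewrite mulf_neq0// gt_eqF// sqrtr_gt0.
have s2 : 0 < s ^+ 2 by rewrite exprn_even_gt0.
have p0 := normal_peak_gt0 t0.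
(* With q = (x - m)^2, the factors of [B] come from (1 + |x|)^2 <= 2 (1 + |m|)^2 (1 + q) and 1 + q
   <= (1 + 4 s^2) (1 + q / (4 s^2)). The last factor is at most exp (q / (4 s^2)), half of the
   exponent. *)
pose B : R := 2 * (1 + `|m|) ^+ 2 * (1 + 4 * s ^+ 2).
have B0 : 0 <= B by rewrite !mulr_ge0 ?sqr_ge0// addr_ge0// mulr_ge0// ltW.
exists (B * normal_peak s / normal_peak (Num.sqrt 2 * s)).
  by rewrite divr_ge0 ?(mulr_ge0 B0) ?normal_peak_ge0.
move=> x; rewrite !normal_pdfE// /normal_fun.
rewrite [leRHS]mulrA divfK ?gt_eqF// mulrCA [leRHS]mulrAC [leRHS]mulrC.
rewrite ler_wpM2l ?normal_peak_ge0//.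
have -> : (Num.sqrt 2 * s) ^+ 2 *+ 2 = 4 * s ^+ 2 :> R.
  by rewrite exprMn sqr_sqrtr// -mulr_natr; ring.
set q := (x - m) ^+ 2.
have q0 : 0 <= q by rewrite sqr_ge0.
have -> : - q / (s ^+ 2 *+ 2) = - q / (4 * s ^+ 2) + - q / (4 * s ^+ 2) :> R.
  by rewrite -mulr_natr; field; rewrite s0.
rewrite expRD mulrA; rewrite ler_wpM2r ?expR_ge0//.
rewrite mulNr expRN ler_pdivrMr ?expR_gt0//.
have H1 : (1 + `|x|) ^+ 2 <= 2 * (1 + `|m|) ^+ 2 * (1 + q).
  have h : 1 + `|x| <= (1 + `|m|) * (1 + `|x - m|).
    have := ler_normD (x - m) m; rewrite subrK.
    have := normr_ge0 m; have := normr_ge0 (x - m); nra.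
  apply: (@le_trans _ _ ((1 + `|m|) ^+ 2 * (1 + `|x - m|) ^+ 2)).
    by rewrite -exprMn lerXn2r// nnegrE ?mulr_ge0 ?addr_ge0.
  rewrite [leRHS](_ : _ = (1 + `|m|) ^+ 2 * (2 * (1 + q))); last by ring.
  rewrite ler_wpM2l ?sqr_ge0//.
  rewrite /q -(real_normK (num_real (x - m))).
  have := sqr_ge0 (1 - `|x - m|); lra.
apply: (le_trans H1); rewrite /B -[leRHS]mulrA ler_wpM2l ?mulr_ge0 ?sqr_ge0//.
apply: (@le_trans _ _ ((1 + 4 * s ^+ 2) * (1 + q / (4 * s ^+ 2)))).
  have h : 0 <= q / (4 * s ^+ 2) by rewrite mulr_ge0// invr_ge0 mulr_ge0// ltW.
  have : q = q / (4 * s ^+ 2) * (4 * s ^+ 2).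
    by rewrite divfK// mulf_neq0 ?gt_eqF.
  nra.
by rewrite ler_wpM2l ?expR_ge1Dx// addr_ge0// mulr_ge0// ltW.
Qed.

Lemma integrable_normal_sqr : N.-integrable setT (fun x => ((1 + `|x|) ^+ 2)%:E).
Proof.
have msqr : measurable_fun [set: R] (fun x : R => (1 + `|x|) ^+ 2).
  by apply: measurable_funX; apply: measurable_funD => //; exact: normr_measurable.
apply: (@integrable_normal_prob _ _ _ (fun x => (1 + `|x|) ^+ 2)) => //.
have [C C0 HC] := normal_pdf_sqr_le.
apply: (@integrable_le_integrable _ _ _ mu _
   (fun x => C * normal_pdf m (Num.sqrt 2 * s) x)).
- by apply: measurable_funM => //; exact: measurable_normal_pdf.
- by move=> x; rewrite ger0_norm ?HC// mulr_ge0 ?sqr_ge0 ?normal_pdf_ge0.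
- by apply: integrable_scale; exact: integrable_normal_pdf.
Qed.

(** With p the density, s^2 f' p - (x - m) f p is the derivative of s^2 f p, so its integral is the
    difference of the limits of s^2 f p at infinity. The growth conditions make both sides
    integrable and these limits 0. *)
Lemma stein_normal (f f' : R -> R) (K : R) :
  (forall x, is_derive x (1 : R) f (f' x)) -> continuous f' ->
  (forall x, `|f x| <= K * (1 + `|x|)) -> (forall x, `|f' x| <= K) ->
  (\int[N]_x ((x - m) * f x)%:E = \int[N]_x (s ^+ 2 * f' x)%:E)%E.
Proof.
move=> df cf' Kf Kf'.
have K0 : 0 <= K by exact: le_trans (normr_ge0 _) (Kf' 0).
have cf : continuous f by move=> x; exact: is_derive_continuous (df x).
have s2 : 0 < s ^+ 2 by rewrite exprn_even_gt0.
pose p := normal_pdf m s.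
have p0 x : 0 <= p x by exact: normal_pdf_ge0.
have cp : continuous p by exact: continuous_normal_pdf.
pose G x := s ^+ 2 * f' x - (x - m) * f x.
have cG : continuous G.
  move=> x; apply: cvgB; apply: cvgM; [exact: cvg_cst|exact: cf'| |exact: cf].
  by apply: cvgB; [exact: cvg_id|exact: cvg_cst].
have G_le x : `|G x| <= K * (s ^+ 2 + 1 + `|m|) * (1 + `|x|) ^+ 2.
  have aux (a b c u v : R) : 0 <= a -> 0 <= b -> 0 <= u -> c <= a + b ->
      u <= K * (1 + a) -> v <= K ->
      s ^+ 2 * v + c * u <= K * (s ^+ 2 + 1 + b) * (1 + a) ^+ 2.
    move=> a0 b0 u0 cab uK vK.
    have h1 : s ^+ 2 * v <= K * s ^+ 2 * (1 + a) ^+ 2.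
      apply: (@le_trans _ _ (s ^+ 2 * K)); first by rewrite ler_pM2l.
      rewrite [s ^+ 2 * K]mulrC ler_peMr//; first by rewrite mulr_ge0// ltW.
      by nra.
    have h2 : c * u <= (a + b) * (K * (1 + a)).
      by rewrite (le_trans (ler_wpM2r u0 cab))// ler_wpM2l// addr_ge0.
    have h3 : a + b <= (1 + b) * (1 + a) by nra.
    have h4 : (a + b) * (K * (1 + a)) <= (1 + b) * (1 + a) * (K * (1 + a)).
      by rewrite ler_wpM2r// mulr_ge0// addr_ge0.
    rewrite [leRHS](_ : _ = K * s ^+ 2 * (1 + a) ^+ 2 +
      (1 + b) * (1 + a) * (K * (1 + a))); last by ring.
    by rewrite lerD// (le_trans h2).
  rewrite (le_trans (ler_normB _ _))// (normrM (s ^+ 2)) (normrM (x - m)) (ger0_norm (ltW s2)).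
  by apply: aux => //; exact: ler_normB.
have mG : measurable_fun [set: R] G by exact: continuous_measurable_fun.
have iG : N.-integrable setT (EFin \o G).
  apply: (@integrable_le_integrable _ _ _ N _ _ mG G_le).
  by apply: integrable_scale; exact: integrable_normal_sqr.
have mf : measurable_fun [set: R] f by exact: continuous_measurable_fun.
have mf' : measurable_fun [set: R] f' by exact: continuous_measurable_fun.
have if' : N.-integrable setT (fun x => (s ^+ 2 * f' x)%:E).
  apply: integrable_scale.
  apply: (@integrable_le_integrable _ _ _ N _ (cst K)) => //.
  exact: finite_measure_integrable_cst.
have iF : N.-integrable setT (fun x => ((x - m) * f x)%:E).
  have := integrableB measurableT if' iG; apply: eq_integrable => // x _.
  by rewrite /= -EFinB /G opprB addrC subrK.
suff : (\int[N]_x (G x)%:E = 0)%E.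
  under eq_integral do rewrite EFinB.
  rewrite integralB// => /eqP; rewrite sube_eq ?add0e; first by move/eqP.
    exact: integrable_fin_num.
  by rewrite fin_num_adde_defr.
rewrite integral_normal_prob//.
have [C C0 HC] := normal_pdf_sqr_le.
pose H x := s ^+ 2 * (f x * p x).
(* The density absorbs (1 + |x|)^2: one power pays for the growth of [f], the other leaves a decay
   of order 1 / (n + 1). *)
have Hlim (u : nat -> R) : (forall n, `|u n| = n%:R) -> H (u n) @[n --> \oo] --> 0.
  move=> un; pose B := s ^+ 2 * K * C * normal_peak (Num.sqrt 2 * s).
  have Hle n : `|H (u n)| <= B / n.+1%:R.
    rewrite ler_pdivlMr ?ltr0n// /H (normrM (s ^+ 2)) (normrM (f _)) (ger0_norm (p0 _)) (ger0_norm (ltW s2)).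
    have t0 : Num.sqrt 2 * s != 0 :> R by rewrite mulf_neq0// gt_eqF// sqrtr_gt0.
    rewrite [leRHS](_ : _ = s ^+ 2 * (K * (C * normal_peak (Num.sqrt 2 * s)))); last first.
      by rewrite /B; ring.
    rewrite -[leLHS]mulrA ler_pM2l//.
    apply: (@le_trans _ _ (K * ((1 + `|u n|) ^+ 2 * p (u n)))).
      rewrite -natr1 -un [_ + 1]addrC expr2.
      have := Kf (u n); have := p0 (u n).
      have := normr_ge0 (u n); move: `|u n| `|f _| (p _) => a b c a0 c0 bK.
      rewrite [X in _ <= X](_ : _ = (K * (1 + a)) * (c * (1 + a))); last by ring.
      by rewrite -[leLHS]mulrA ler_wpM2r// mulr_ge0// addr_ge0.
    rewrite ler_wpM2l// (le_trans (HC _))// ler_wpM2l//.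
    exact: normal_pdf_ub.
  apply/norm_cvg0P; apply: (@squeeze_cvgr _ _ _ _ (cst 0) (fun n => B / n.+1%:R)).
  - by apply: nearW => n; rewrite normr_ge0 Hle.
  - exact: cvg_cst.
  - rewrite -(mulr0 B); apply: cvgM; first exact: cvg_cst.
    exact: cvg_harmonic.
apply: (@integral_derive_eq0 _ H (fun x => G x * p x)).
- move=> x; have dfx := df x; have dpx := is_derive_normal_pdf x.
  rewrite /H /p; apply: is_derive_eq.
  rewrite /GRing.scale/= /G; field.
  by rewrite s0.
- by move=> x; apply: cvgM; [exact: cG|exact: cp].
- apply: (@integrable_le_integrable _ _ _ mu _ (fun x =>
    K * (s ^+ 2 + 1 + `|m|) * C * normal_pdf m (Num.sqrt 2 * s) x)).
  + by apply: measurable_funM => //; exact: measurable_normal_pdf.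
  + move=> x; rewrite normrM (ger0_norm (p0 x)).
    apply: (le_trans (ler_wpM2r (p0 x) (G_le x))).
    rewrite -[leRHS]mulrA -[leLHS]mulrA ler_wpM2l ?mulr_ge0//.
    by rewrite !addr_ge0// ltW.
  + by apply: integrable_scale; exact: integrable_normal_pdf.
- by apply: Hlim => n; rewrite normr_nat.
- by apply: Hlim => n; rewrite normrN normr_nat.
Qed.

End normal_stein.

(** * Products of normal distributions on tuples *)

Section tuple_cons.
Context (R : realType) (n : nat).

(** Registered below as a measurable function, so that a product measure can be pushed along it by
    [distribution]. *)
Definition tcons (xt : measurableTypeR R * n.-tuple R) : n.+1.-tuple R := [tuple of xt.1 :: xt.2].

Lemma measurable_tcons : measurable_fun setT tcons.
Proof.
apply: measurable_cons => //.
Qed.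

HB.instance Definition _ := isMeasurableFun.Build _ _ _ _ tcons measurable_tcons.

Lemma tnth_tcons0 xt : tnth (tcons xt) ord0 = xt.1.
Proof. by []. Qed.

Lemma tnth_tconsS xt (i : 'I_n) : tnth (tcons xt) (lift ord0 i) = tnth xt.2 i.
Proof. by rewrite /tcons tnthS. Qed.

End tuple_cons.

(* [s] lists standard deviations, not variances. *)
Fixpoint gauss (R : realType) (n : nat) :
    ('I_n -> R) -> ('I_n -> R) -> probability (n.-tuple R) R :=
  match n with
  | 0 => fun _ _ => dirac [tuple]
  | n'.+1 => fun m s =>
     distribution (normal_prob (m ord0) (s ord0) \x
                    gauss (fun i => m (lift ord0 i)) (fun i => s (lift ord0 i)))%E
                  (@tcons R n')
  end.
Arguments gauss {R n}.

Section law.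
Context d d' (T : measurableType d) (T' : measurableType d') (R : realType).
Variables (mu : {measure set T -> \bar R}) (nu : {measure set T' -> \bar R}).
Variable phi : T -> T'.
Hypotheses (mphi : measurable_fun setT phi)
  (law : forall A, measurable A -> mu (phi @^-1` A) = nu A).

Lemma ge0_integral_law (f : T' -> \bar R) : measurable_fun setT f ->
  (forall x, 0 <= f x)%E -> (\int[mu]_x f (phi x) = \int[nu]_y f y)%E.
Proof.
move=> mf f0; transitivity (\int[pushforward mu phi]_y f y)%E.
  by rewrite ge0_integral_pushforward.
pose mu' : {measure set T' -> \bar R} :=
  measure_function_pushforward__canonical__measure_function_Measure mu mphi.
by apply: (@eq_measure_integral _ _ _ _ nu mu') => A mA _; exact: law.
Qed.

Lemma integrable_lawP (f : T' -> \bar R) : measurable_fun setT f ->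
  mu.-integrable setT (fun x => f (phi x)) <-> nu.-integrable setT f.
Proof.
move=> mf; have mf' : measurable_fun setT (fun x => f (phi x)).
  exact: measurableT_comp.
have E : (\int[mu]_x `|f (phi x)| = \int[nu]_y `|f y|)%E.
  apply: (ge0_integral_law (f := fun y => `|f y|%E)) => //.
  exact: measurableT_comp.
by split=> /integrableP[_ h]; apply/integrableP; split => //; rewrite ?E// -E.
Qed.

Lemma integral_law (f : T' -> \bar R) : nu.-integrable setT f ->
  (\int[mu]_x f (phi x) = \int[nu]_y f y)%E.
Proof.
move=> intf; have mf := measurable_int _ intf.
rewrite [LHS]integralE [RHS]integralE; congr (_ - _)%E.
  rewrite -ge0_integral_law//; last exact: measurable_funepos.
  by apply: eq_integral => x _; rewrite funepos_comp.
rewrite -ge0_integral_law//; last exact: measurable_funeneg.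
by apply: eq_integral => x _; rewrite funeneg_comp.
Qed.

End law.

Section fubini_eq.
Context d1 d2 (T1 : measurableType d1) (T2 : measurableType d2) (R : realType).
Variables (m1 : probability T1 R) (m2 : probability T2 R).
Variables f g : T1 * T2 -> \bar R.
Hypotheses (intf : (m1 \x m2)%E.-integrable setT f)
  (intg : (m1 \x m2)%E.-integrable setT g).

(** Integrates over one variable an identity known with that variable frozen. Its price is the
    integrability of both sides on the product, which is why uniform bounds are carried along
    everywhere. *)
Lemma eq_integral_fubini1 :
  (forall x, \int[m2]_y f (x, y) = \int[m2]_y g (x, y))%E ->
  (\int[m1 \x m2]_z f z = \int[m1 \x m2]_z g z)%E.
Proof.
move=> fg; rewrite -!integral12_prod_meas1//.
by apply: eq_integral => x _; exact: fg.
Qed.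

Lemma eq_integral_fubini2 :
  (forall y, \int[m1]_x f (x, y) = \int[m1]_x g (x, y))%E ->
  (\int[m1 \x m2]_z f z = \int[m1 \x m2]_z g z)%E.
Proof.
move=> fg; rewrite -!integral21_prod_meas1//.
by apply: eq_integral => x _; exact: fg.
Qed.

End fubini_eq.

Section product_marginals.
Context d1 d2 (T1 : measurableType d1) (T2 : measurableType d2) (R : realType).
Variables (m1 : probability T1 R) (m2 : probability T2 R).

Lemma law_fst A : measurable A -> (m1 \x m2)%E (fst @^-1` A) = m1 A.
Proof.
move=> mA; rewrite (_ : _ @^-1` _ = A `*` setT); last first.
  by apply/seteqP; split => [[x y]|[x y] []].
rewrite (product_measure1E m1 m2 mA measurableT).
by rewrite [X in (_ * X)%E](_ : _ = 1%E) ?mule1//; exact: probability_setT.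
Qed.

Lemma law_snd A : measurable A -> (m1 \x m2)%E (snd @^-1` A) = m2 A.
Proof.
move=> mA; rewrite (_ : _ @^-1` _ = setT `*` A); last first.
  by apply/seteqP; split => [[x y]|[x y] []].
rewrite (product_measure1E m1 m2 measurableT mA).
by rewrite [X in (X * _)%E](_ : _ = 1%E) ?mul1e//; exact: probability_setT.
Qed.

End product_marginals.

Lemma measurable_coord (R : realType) n (i : 'I_n) :
  measurable_fun setT (fun x : n.-tuple R => tnth x i : measurableTypeR R).
Proof. exact: measurable_tnth. Qed.

Lemma gauss_tnth (R : realType) n (m s : 'I_n -> R) (i : 'I_n)
    (A : set (measurableTypeR R)) : measurable A ->
  gauss m s [set x | A (tnth x i)] = normal_prob (m i) (s i) A.
Proof.
move=> mA; elim: n m s i => [|n IH] m s i; first by case: i.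
case: (unliftP ord0 i) => [j ->|->].
- have mB : measurable [set x : n.-tuple R | A (tnth x j)].
    by have := measurable_coord j; rewrite -[X in measurable X]setTI; apply.
  rewrite -(IH (m \o lift ord0) (s \o lift ord0) j)//.
  rewrite -(law_snd (normal_prob (m ord0) (s ord0))
             (gauss (m \o lift ord0) (s \o lift ord0)) mB).
  congr ((_ \x _)%E _); apply/seteqP; split => x /=; by rewrite tnthS.
- exact: (law_fst (normal_prob (m ord0) (s ord0))
             (gauss (m \o lift ord0) (s \o lift ord0)) mA).
Qed.

(** Freezes all coordinates but one, so that a partial derivative becomes the derivative of a
    function on the line. *)
Definition upd (R : realType) n (x : n.-tuple R) (i : 'I_n) (y : R) : n.-tuple R :=
  [tuple if j == i then y else tnth x j | j < n].

Lemma tnth_upd (R : realType) n (x : n.-tuple R) i y j :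
  tnth (upd x i y) j = if j == i then y else tnth x j.
Proof. by rewrite tnth_mktuple. Qed.

Lemma upd_tcons0 (R : realType) n (x : R) (t : n.-tuple R) y :
  upd (tcons (x, t)) ord0 y = tcons (y, t).
Proof.
apply: eq_from_tnth => j; rewrite tnth_upd.
case: (unliftP ord0 j) => [k ->|->]; last by rewrite eqxx tnth_tcons0.
by rewrite !tnth_tconsS eq_sym (negbTE (neq_lift _ _)).
Qed.

Lemma upd_tconsS (R : realType) n (x : R) (t : n.-tuple R) i y :
  upd (tcons (x, t)) (lift ord0 i) y = tcons (x, upd t i y).
Proof.
apply: eq_from_tnth => j; rewrite tnth_upd.
case: (unliftP ord0 j) => [k ->|->]; first by rewrite !tnth_tconsS tnth_upd (inj_eq lift_inj).
by rewrite !tnth_tcons0 (negbTE (neq_lift _ _)).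
Qed.

(** From |x - m| <= |x| + |m| <= (1 + |m|) (1 + |x|): a function of linear growth, once multiplied
    by x - m, is dominated by the quadratic whose Gaussian integrability is known. *)
Lemma stein_term_le (R : realFieldType) (K x m f : R) :
  `|f| <= K * (1 + `|x|) ->
  `|(x - m) * f| <= K * (1 + `|m|) * (1 + `|x|) ^+ 2.
Proof.
have aux (a b c u : R) : 0 <= a -> 0 <= b -> 0 <= u -> c <= a + b ->
    u <= K * (1 + a) -> c * u <= K * (1 + b) * (1 + a) ^+ 2.
  move=> a0 b0 u0 cab uK.
  have h2 : c * u <= (a + b) * (K * (1 + a)).
    by rewrite (le_trans (ler_wpM2r u0 cab))// ler_wpM2l// addr_ge0.
  have h3 : a + b <= (1 + b) * (1 + a) by nra.
  rewrite (le_trans h2)// [leRHS](_ : _ = (1 + b) * (1 + a) * (K * (1 + a))).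
    by rewrite ler_wpM2r// (le_trans u0).
  by ring.
by move=> fK; rewrite normrM; apply: aux => //; exact: ler_normB.
Qed.

Section gauss_moments.
Context (R : realType) (n : nat) (m s : 'I_n -> R).

Lemma integrable_gauss_sqr (i : 'I_n) : s i != 0 ->
  (gauss m s).-integrable setT (EFin \o (fun x => (1 + `|tnth x i|) ^+ 2)).
Proof.
move=> s0.
have := @integrable_lawP _ _ _ _ R (gauss m s) (normal_prob (m i) (s i))
  _ (@measurable_coord R n i) (@gauss_tnth R n m s i)
  (fun y => ((1 + `|y|) ^+ 2)%:E).
case.
  apply/measurable_EFinP.
  have : measurable_fun [set: R] (fun y : R => (1 + `|y|) ^+ 2).
    by apply: measurable_funX; apply: measurable_funD => //; exact: normr_measurable.
  exact.
by move=> _; apply; exact: integrable_normal_sqr.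
Qed.

Lemma integrable_gauss_stein (i : 'I_n) (f : n.-tuple R -> R) (K : R) :
  s i != 0 -> measurable_fun setT f ->
  (forall x, `|f x| <= K * (1 + `|tnth x i|)) ->
  (gauss m s).-integrable setT (EFin \o (fun x => (tnth x i - m i) * f x)).
Proof.
move=> s0 mf Kf.
apply: (@integrable_le_integrable _ _ _ (gauss m s) _
    (fun x => K * (1 + `|m i|) * (1 + `|tnth x i|) ^+ 2)).
- apply: measurable_funM => //; apply: measurable_funB => //.
  exact: measurable_tnth.
- by move=> x; exact: stein_term_le.
- by apply: integrable_scale; exact: integrable_gauss_sqr.
Qed.

End gauss_moments.

(** Induction along the recursive construction of [gauss]: if [i] is the head, the tail is frozen
    and the univariate identity applies; otherwise the head is frozen and the induction hypothesis
    applies to the tail. *)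
Lemma stein_gauss (R : realType) n (m s : 'I_n -> R) (i : 'I_n)
    (f f' : n.-tuple R -> R) (K : R) : s i != 0 ->
  measurable_fun setT f -> measurable_fun setT f' ->
  (forall x (y : R), is_derive y 1 (fun y => f (upd x i y)) (f' (upd x i y))) ->
  (forall x, continuous (fun y => f' (upd x i y))) ->
  (forall x, `|f x| <= K * (1 + `|tnth x i|)) -> (forall x, `|f' x| <= K) ->
  (\int[gauss m s]_x ((tnth x i - m i) * f x)%:E =
   \int[gauss m s]_x (s i ^+ 2 * f' x)%:E)%E.
Proof.
elim: n m s i f f' => [|n IH] m s i f f' si0 mf mf' df cf' Kf Kf'; first by have := ltn_ord i.
pose N := normal_prob (m ord0) (s ord0).
pose G := gauss (m \o lift ord0) (s \o lift ord0).
have L A : measurable A -> (N \x G)%E (@tcons R n @^-1` A) = gauss m s A by [].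
have i1 : (gauss m s).-integrable setT (EFin \o (fun x => (tnth x i - m i) * f x)).
  exact: integrable_gauss_stein Kf.
have i2 : (gauss m s).-integrable setT (EFin \o (fun x => s i ^+ 2 * f' x)).
  apply: integrable_scale.
  apply: (@integrable_le_integrable _ _ _ (gauss m s) _ (cst K)) => //.
  exact: finite_measure_integrable_cst.
rewrite -(integral_law (@measurable_tcons R n) L i1).
rewrite -(integral_law (@measurable_tcons R n) L i2).
have {}i1 := (integrable_lawP (@measurable_tcons R n) L (measurable_int _ i1)).2 i1.
have {}i2 := (integrable_lawP (@measurable_tcons R n) L (measurable_int _ i2)).2 i2.
have mc y : measurable_fun setT (fun t : n.-tuple R => tcons (y, t)).
  exact: (measurable_cons (f := fun=> y) (g := id)).
move: si0 df cf' Kf i1 i2.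
case: (unliftP ord0 i) => [j ->|->] si0 df cf' Kf i1 i2.
- apply: eq_integral_fubini1 => // y /=.
  under eq_integral do rewrite tnth_tconsS.
  apply: (IH (m \o lift ord0) (s \o lift ord0) j
    (fun t => f (tcons (y, t))) (fun t => f' (tcons (y, t)))) => //=.
  + exact: measurableT_comp mf (mc y).
  + exact: measurableT_comp mf' (mc y).
  + move=> t z; have := df (tcons (y, t)) z.
    by under eq_fun do rewrite upd_tconsS; rewrite upd_tconsS.
  + by move=> t; have := cf' (tcons (y, t)); under eq_fun do rewrite upd_tconsS.
  + by move=> t; rewrite (le_trans (Kf _))// tnth_tconsS.
- apply: eq_integral_fubini2 => // t /=.
  apply: (@stein_normal _ _ _ si0 (fun y => f (tcons (y, t)))
    (fun y => f' (tcons (y, t))) K).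
  + move=> y; have := df (tcons (0, t)) y.
    by under eq_fun do rewrite upd_tcons0; rewrite upd_tcons0.
  + by have := cf' (tcons (0, t)); under eq_fun do rewrite upd_tcons0.
  + by move=> y; rewrite (le_trans (Kf _)).
  + by move=> y; exact: Kf'.
Qed.

(** * Normal laws with diagonal covariance, and the chi-square law, through [gauss] *)

Lemma invmx_diag (R : fieldType) n (d : 'I_n -> R) : (forall i, d i != 0) ->
  invmx (diag_mx (\row_i d i)) = diag_mx (\row_i (d i)^-1).
Proof.
move=> d0; set D := diag_mx _; set E := diag_mx _.
have DE : D *m E = 1%:M.
  apply/matrixP => i j; rewrite mul_diag_mx !mxE.
  by case: eqVneq => [->|]; rewrite ?mulr1n ?mulr0n ?mulr0// divff.
have [_ invDE] := mulmx1_unit DE.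
by rewrite -[invmx D]mulmx1 -DE mulmxA mulVmx ?mul1mx//; case: (mulmx1_unit DE).
Qed.

Lemma quad_diag (R : fieldType) n (d : 'I_n -> R) (x : 'cV[R]_n) :
  (x^T *m diag_mx (\row_i d i) *m x) 0 0 = \sum_i d i * x i 0 ^+ 2.
Proof.
rewrite mxE; apply: eq_bigr => i _.
by rewrite mul_mx_diag !mxE mulrAC mulrC -expr2.
Qed.

Section mvnormal_diag.
Context (R : realType).

Lemma sqrtr_prod (I : Type) (r : seq I) (a : I -> R) : (forall i, 0 <= a i) ->
  Num.sqrt (\prod_(i <- r) a i) = \prod_(i <- r) Num.sqrt (a i).
Proof.
move=> a0; elim: r => [|i r IH]; first by rewrite !big_nil sqrtr1.
by rewrite !big_cons sqrtrM// IH.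
Qed.

Lemma mvnormal_pdf_diag n (mu : 'cV[R]_n) (v : 'I_n -> R) (x : n.-tuple R) :
  (forall i, 0 < v i) ->
  mvnormal_pdf mu (diag_mx (\row_i v i)) x =
  \prod_i normal_pdf (mu i 0) (Num.sqrt (v i)) (tnth x i).
Proof.
move=> v0; have vN0 i : v i != 0 by rewrite gt_eqF.
rewrite /mvnormal_pdf invmx_diag// quad_diag det_diag.
under eq_bigr do rewrite mxE.
under [RHS]eq_bigr do rewrite normal_pdfE ?gt_eqF ?sqrtr_gt0//.
rewrite big_split/= /normal_fun -expR_sum /normal_peak prodfV; congr (_^-1 * expR _).
  rewrite -sqrtr_prod; last by move=> i; rewrite mulrn_wge0// mulr_ge0 ?sqr_ge0 ?pi_ge0.
  congr Num.sqrt; rewrite -[in (2 * pi) ^+ n](card_ord n) -prodr_const -big_split/=.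
  apply: eq_bigr => i _; rewrite sqr_sqrtr ?ltW// -mulr_natr; ring.
rewrite mulNr -mulrN mulr_suml; apply: eq_bigr => i _.
by rewrite !mxE sqr_sqrtr ?ltW// -mulr_natr; field.
Qed.

(** The constant [K] makes the induction possible: for the inner iterated integral the density of
    the outermost coordinate is a constant, and it is absorbed into [K]. *)
Lemma iint_gauss n (m s : 'I_n -> R) (A : set (n.-tuple R)) (K : R) :
  measurable A -> 0 <= K ->
  lebesgue_iint (fun x =>
    (\1_A x * (K * \prod_i normal_pdf (m i) (s i) (tnth x i)))%:E) =
  (K%:E * gauss m s A)%E.
Proof.
elim: n m s A K => [|n IH] m s A K mA K0.
  by rewrite /= big_ord0 mulr1 mulrC EFinM /dirac.
pose N := normal_prob (m ord0) (s ord0).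
pose G := gauss (m \o lift ord0) (s \o lift ord0).
have mB : measurable (@tcons R n @^-1` A).
  by rewrite -[X in measurable X]setTI; apply: measurable_tcons.
have mG := measurable_fun_xsection G mB.
have mp : measurable_fun setT (fun x => (normal_pdf (m ord0) (s ord0) x)%:E).
  by apply/measurable_EFinP; exact: measurable_normal_pdf.
transitivity (\int[lebesgue_measure]_x (K%:E *
   (G (xsection (@tcons R n @^-1` A) x) * (normal_pdf (m ord0) (s ord0) x)%:E)))%E.
  apply: eq_integral => x _.
  rewrite muleCA -EFinM muleC.
  rewrite -(IH (m \o lift ord0) (s \o lift ord0)); last 2 first.
  - exact: measurable_xsection.
  - by rewrite mulr_ge0 ?normal_pdf_ge0.
  congr lebesgue_iint; apply/funext => t; congr (_ %:E).
  rewrite big_ord_recl (mulrA K); congr (_ * (_ * _)).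
    by rewrite !indicE mem_xsection; congr ((nat_of_bool _)%:R); apply/idP/idP; rewrite !inE.
  by apply: eq_bigr => i _; rewrite (tnth_tconsS (x, t)).
rewrite ge0_integralZl//; last first.
- by move=> x _; rewrite mule_ge0// lee_fin normal_pdf_ge0.
- by apply: emeasurable_funM => //.
congr (_ * _)%E; rewrite -integral_normal_prob//.
(* The section has [G]-measure at most 1, so as a real-valued function it is bounded and integrable
   under the normal law. *)
have mf : measurable_fun setT (fun x => fine (G (xsection (@tcons R n @^-1` A) x))).
  exact: measurableT_comp.
rewrite (_ : (fun x => _) = EFin \o (fun x => fine (G (xsection (@tcons R n @^-1` A) x)))).
  apply: (@measurable_bounded_integrable _ _ _ N) => //.
  - exact: (le_lt_trans (probability_le1 N measurableT) (ltry _)).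
  - exists 1; split; first exact: num_real.
    move=> M M1 x _ /=; rewrite ger0_norm ?fine_ge0// (le_trans _ (ltW M1))//.
    have mx := measurable_xsection x mB.
    by rewrite -lee_fin fineK ?fin_num_measure//; exact: probability_le1.
apply/funext => x /=; rewrite fineK// fin_num_measure//.
exact: measurable_xsection.
Qed.

End mvnormal_diag.

Lemma mvnormal_gauss (R : realType) n (mu : 'cV[R]_n) (v : 'I_n -> R)
    (A : set (n.-tuple R)) : (forall i, 0 < v i) -> measurable A ->
  mvnormal mu (diag_mx (\row_i v i)) A =
  gauss (fun i => mu i 0) (fun i => Num.sqrt (v i)) A.
Proof.
move=> v0 mA; rewrite -[RHS]mul1e -iint_gauss//; congr lebesgue_iint.
by apply/funext => x; rewrite mul1r mvnormal_pdf_diag.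
Qed.

Lemma sqnorm_colv (R : realType) n (x : n.-tuple R) :
  sqnorm (colv x) = \sum_i tnth x i ^+ 2.
Proof. by apply: eq_bigr => i _; rewrite mxE. Qed.

Lemma measurable_sqnorm (R : realType) n :
  measurable_fun setT (fun x : n.-tuple R => sqnorm (colv x)).
Proof.
under eq_fun do rewrite sqnorm_colv.
by apply: measurable_sum => i; apply: measurable_funX; exact: measurable_tnth.
Qed.

Lemma chi_square_gauss (R : realType) n (A : set R) : measurable A ->
  chi_square n A = gauss (fun=> 0) (fun=> 1) [set z : n.-tuple R | A (sqnorm (colv z))].
Proof.
move=> mA; rewrite /chi_square.
have -> : 1%:M = diag_mx (\row_(i < n) 1) :> 'M[R]_n.
  by apply/matrixP => i j; rewrite !mxE.
have e0 : (fun i : 'I_n => (0 : 'cV[R]_n) i 0) = fun=> 0.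
  by apply/funext => i; rewrite mxE.
rewrite mvnormal_gauss ?e0 ?sqrtr1//.
by rewrite -[X in measurable X]setTI; exact: measurable_sqnorm.
Qed.

(** * The canonical model on a product space *)

Section independence.
Context (R : realType) d d1 d2 d3 (T : measurableType d)
  (T1 : measurableType d1) (T2 : measurableType d2) (T3 : measurableType d3).
Variables (P : probability T R) (X1 : {mfun T >-> T1}) (X2 : {mfun T >-> T2})
  (X3 : {mfun T >-> T3}).
Hypothesis ind : independent3 P X1 X2 X3.

Let mpre d' (T' : measurableType d') (X : {mfun T >-> T'}) A :
  measurable A -> measurable (X @^-1` A).
Proof. by move=> mA; rewrite -[X in measurable X]setTI; exact: measurable_funP. Qed.

Lemma independent_pair (B : set (T1 * T2)) (C : set T3) :
  measurable B -> measurable C ->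
  P ((fun w => (X1 w, X2 w)) @^-1` B `&` X3 @^-1` C) =
  ((distribution P X1 \x distribution P X2) B * P (X3 @^-1` C))%E.
Proof.
move=> mB mC; set D := X3 @^-1` C.
have mD : measurable D by exact: mpre.
have PD : P D \is a fin_num by exact: fin_num_measure.
have PD0 : 0 <= fine (P D) by exact: fine_ge0.
(* As a nonnegative real, the weight P(D) can scale the second marginal; both sides are then
   compared with the product of [distribution P X1] and that scaled marginal. *)
pose r : {nonneg R} := NngNum PD0.
have rE : r%:num%:E = P D by rewrite /= fineK.
have m12 : measurable_fun setT (fun w => (X1 w, X2 w)) by exact: measurable_fun_pair.
pose PrD : {measure set T -> \bar R} := mrestr P mD.
pose m' : {measure set (T1 * T2) -> \bar R} :=
  measure_function_pushforward__canonical__measure_function_Measure PrD m12.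
pose m'' : {measure set (T1 * T2) -> \bar R} :=
  mscale r (distribution P X1 \x distribution P X2)%E.
(* For fixed [C], both sides are finite measures in [B] that agree on rectangles. *)
have h1 := @product_measure_unique _ _ _ _ _ (distribution P X1)
  (mscale r (distribution P X2)) m'.
have h2 := @product_measure_unique _ _ _ _ _ (distribution P X1)
  (mscale r (distribution P X2)) m''.
transitivity (m' B) => //; rewrite -h1//.
  rewrite h2//; first by rewrite /m'' /= /mscale rE muleC.
  move=> A1 A2 mA1 mA2; rewrite /m'' /= /mscale.
  transitivity (r%:num%:E * (distribution P X1 A1 * distribution P X2 A2))%E.
    by congr (_ * _)%E; exact: product_measure1E.
  by rewrite muleCA.
move=> A1 A2 mA1 mA2; rewrite /m' /= /pushforward /PrD /= /mrestr /mscale rE.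
rewrite /distribution /pushforward muleA muleAC.
by rewrite -(ind mA1 mA2 mC).
Qed.

End independence.

(* [S] is realized as [sigma2 * |z|^2] with [z] standard normal on [R^N]. *)
Section canonical_space.
Context (R : realType) d (T : measurableType d) (l q N : nat).
Variables (dd : 'I_l -> R) (V : {mfun T >-> l.-tuple R})
  (Vs : {mfun T >-> q.-tuple R}) (S : {mfun T >-> R}) (P : probability T R).
Variables (theta : 'cV[R]_l) (mu : 'cV[R]_q) (sigma2 : R).
Hypotheses (dd0 : forall i, 0 < dd i) (sigma20 : 0 < sigma2).
Hypothesis model :
  canonical_model N (diag_mx (\row_i dd i)) V Vs S (theta, mu, sigma2) P.

Definition canon_V : probability (l.-tuple R) R :=
  gauss (fun i => theta i 0) (fun i => Num.sqrt (sigma2 * dd i)).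

Definition canon_VVs : probability (l.-tuple R * q.-tuple R)%type R :=
  (canon_V \x distribution P Vs)%E.

Definition canon_Z : probability (N.-tuple R) R := gauss (fun=> 0) (fun=> 1).

Definition canon : probability ((l.-tuple R * q.-tuple R) * N.-tuple R)%type R :=
  (canon_VVs \x canon_Z)%E.

Definition canon_data (w : (l.-tuple R * q.-tuple R) * N.-tuple R) :
  (l.-tuple R * q.-tuple R) * R := (w.1, sigma2 * sqnorm (colv w.2)).

Lemma measurable_canon_S :
  measurable_fun setT (fun z : N.-tuple R => sigma2 * sqnorm (colv z)).
Proof. by apply: measurable_funM => //; exact: measurable_sqnorm. Qed.

Lemma measurable_canon_data : measurable_fun setT canon_data.
Proof.
apply: measurable_fun_pair => //.
by apply: (measurableT_comp measurable_canon_S); exact: measurable_snd.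
Qed.

Let law_V A : measurable A -> distribution P V A = canon_V A.
Proof.
move=> mA; have [hV _ _ _] := model.
rewrite /distribution /pushforward hV//.
rewrite (_ : sigma2 *: _ = diag_mx (\row_i (sigma2 * dd i))); last first.
  by apply/matrixP => i j; rewrite !mxE mulrnAr.
by rewrite mvnormal_gauss// => i; rewrite mulr_gt0.
Qed.

Let law_S C : measurable C ->
  P (S @^-1` C) = canon_Z ((fun z => sigma2 * sqnorm (colv z)) @^-1` C).
Proof.
move=> mC; have [_ _ hS _] := model.
pose C' : set R := ( *%R sigma2) @^-1` C.
have mC' : measurable C'.
  rewrite -[X in measurable X]setTI; have := @mulrl_measurable R setT sigma2.
  by apply.
rewrite (_ : S @^-1` C = (fun w => S w / sigma2) @^-1` C'); last first.
  by apply/seteqP; split => w /=; rewrite /C' /= mulrCA mulfV ?gt_eqF// mulr1.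
by rewrite hS// chi_square_gauss.
Qed.

(** Uniqueness of product measures, applied first to the pair (V, Vs) and then to that pair with S:
    in each case the two laws agree on rectangles. *)
Lemma canonical_law (B : set ((l.-tuple R * q.-tuple R) * R)) : measurable B ->
  P ((fun w => ((V w, Vs w), S w)) @^-1` B) = canon (canon_data @^-1` B).
Proof.
move=> mB; have [_ _ _ ind] := model.
have m123 : measurable_fun setT (fun w => ((V w, Vs w), S w)).
  by apply: measurable_fun_pair => //; exact: measurable_fun_pair.
pose law1 : {measure set ((l.-tuple R * q.-tuple R) * R)%type -> \bar R} :=
  measure_function_pushforward__canonical__measure_function_Measure P m123.
pose law2 : {measure set ((l.-tuple R * q.-tuple R) * R)%type -> \bar R} :=
  measure_function_pushforward__canonical__measure_function_Measure
    canon measurable_canon_data.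
have law_VVs A : measurable A ->
    (distribution P V \x distribution P Vs)%E A = canon_VVs A.
  move=> mA; apply: product_measure_unique => // A1 A2 mA1 mA2.
  transitivity (canon_V A1 * distribution P Vs A2)%E; last by rewrite -law_V.
  exact: product_measure1E.
transitivity (law1 B) => //.
have h1 := @product_measure_unique _ _ _ _ _ canon_VVs (distribution P S) law1.
have h2 := @product_measure_unique _ _ _ _ _ canon_VVs (distribution P S) law2.
rewrite -h1//; first rewrite h2//.
- move=> A C mA mC.
  transitivity (canon_VVs A * canon_Z ((fun z => (sigma2 * sqnorm (colv z))%R) @^-1` C))%E.
    rewrite -product_measure1E//.
    by rewrite -[X in measurable X]setTI; exact: measurable_canon_S.
  by rewrite -law_S.
- move=> A C mA mC.
  transitivity ((distribution P V \x distribution P Vs) A * P (S @^-1` C))%E.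
    by rewrite -(independent_pair ind mA mC).
  by congr (_ * _)%E; exact: law_VVs.
Qed.

(** Both integrals equal the one under the common law of the data, so integrability has to be
    checked only on the explicit space. *)
Lemma canonical_integral (f : (l.-tuple R * q.-tuple R) * R -> R) :
  measurable_fun setT f ->
  canon.-integrable setT (EFin \o (f \o canon_data)) ->
  (\int[P]_w (f ((V w, Vs w), S w))%:E = \int[canon]_x (f (canon_data x))%:E)%E.
Proof.
move=> mf intf.
pose nu : {measure set ((l.-tuple R * q.-tuple R) * R)%type -> \bar R} :=
  measure_function_pushforward__canonical__measure_function_Measure
    canon measurable_canon_data.
have mf' : measurable_fun setT (EFin \o f) by exact/measurable_EFinP.
have intnu : nu.-integrable setT (EFin \o f).
  by apply/(integrable_lawP (nu := nu) measurable_canon_data).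
have m123 : measurable_fun setT (fun w => ((V w, Vs w), S w)).
  by apply: measurable_fun_pair => //; exact: measurable_fun_pair.
have e1 := integral_law m123 (nu := nu) canonical_law intnu.
have e2 := integral_law measurable_canon_data (nu := nu) (fun _ _ => erefl) intnu.
by rewrite e1 -e2.
Qed.

End canonical_space.

Lemma integrable_bounded d (T : measurableType d) (R : realType)
    (P : probability T R) (f : T -> R) (K : R) :
  measurable_fun setT f -> (forall x, `|f x| <= K) ->
  P.-integrable setT (EFin \o f).
Proof.
move=> mf fK; apply: (@integrable_le_integrable _ _ _ P _ (cst K)) => //.
exact: finite_measure_integrable_cst.
Qed.

Lemma integrable_bigsum d (T : measurableType d) (R : realType)
    (mu : {measure set T -> \bar R}) (I : Type) (r : seq I) (f : I -> T -> R) :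
  (forall i, mu.-integrable setT (EFin \o f i)) ->
  mu.-integrable setT (EFin \o (fun x => \sum_(i <- r) f i x)).
Proof.
move=> intf.
have := @integrable_sum _ _ _ mu setT measurableT I r xpredT (fun i => EFin \o f i).
move=> /(_ (fun i _ => intf i)); apply: eq_integrable => // x _ /=.
by rewrite -sumEFin.
Qed.

Lemma integral_bigsum d (T : measurableType d) (R : realType)
    (mu : {measure set T -> \bar R}) (I : Type) (r : seq I) (f : I -> T -> R) :
  (forall i, mu.-integrable setT (EFin \o f i)) ->
  (\int[mu]_x (\sum_(i <- r) f i x)%:E = \sum_(i <- r) \int[mu]_x (f i x)%:E)%E.
Proof.
move=> intf; under eq_integral do rewrite -sumEFin.
by rewrite integral_sum.
Qed.

Lemma sqnorm_upd (R : realType) n (z : n.-tuple R) j (y : R) :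
  sqnorm (colv (upd z j y)) = y ^+ 2 + \sum_(i | i != j) tnth z i ^+ 2.
Proof.
rewrite sqnorm_colv (bigD1 j)//= tnth_upd eqxx; congr (_ + _).
by apply: eq_bigr => i ij; rewrite tnth_upd (negbTE ij).
Qed.

Lemma sqnorm_ge0 (R : realType) n (x : 'cV[R]_n) : 0 <= sqnorm x.
Proof. by apply: sumr_ge0 => i _; exact: sqr_ge0. Qed.

(** * The chi-square identity *)

Section chi.
Context (R : realType) (N : nat) (v : R).
Hypothesis v0 : 0 < v.
Local Notation G := (@gauss R N (fun=> 0) (fun=> 1)).
Local Notation ssq z := (v * sqnorm (colv z)).

Lemma ssq_ge0 (z : N.-tuple R) : 0 <= ssq z.
Proof. by rewrite mulr_ge0 ?sqnorm_ge0// ltW. Qed.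

Lemma tnth_sqr_le (z : N.-tuple R) j : tnth z j ^+ 2 <= sqnorm (colv z).
Proof.
rewrite sqnorm_colv (bigD1 j)//= lerDl.
by apply: sumr_ge0 => i _; exact: sqr_ge0.
Qed.

Lemma integrable_gauss_sqnorm :
  G.-integrable setT (EFin \o (fun z => sqnorm (colv z))).
Proof.
under [fun z => sqnorm _]eq_fun do rewrite sqnorm_colv.
apply: integrable_bigsum => j.
apply: (@integrable_le_integrable _ _ _ G _ (fun z => (1 + `|tnth z j|) ^+ 2)).
- by apply: measurable_funX; exact: measurable_tnth.
- move=> z; rewrite ger0_norm ?sqr_ge0// -real_normK ?num_real//.
  by rewrite lerXn2r ?nnegrE ?addr_ge0// lerDr.
- by apply: integrable_gauss_sqr; exact: oner_neq0.
Qed.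

(** Stein's identity for z_j g(v |z|^2), summed over j. A bound on s g' suffices instead of one on
    g', since v z_j^2 <= v |z|^2; the derivative g + 2 v z_j^2 g' is then at most 3 K. The
    derivative of [g] is required at s = 0 too, because the coordinate functions must be
    differentiable where z vanishes. *)
Lemma chi_gauss (g g' : R -> R) (K : R) :
  measurable_fun setT g -> measurable_fun setT g' ->
  (forall s : R, 0 <= s -> is_derive s 1 g (g' s)) ->
  (forall s : R, 0 <= s -> {for s, continuous g'}) ->
  (forall s, 0 <= s -> `|g s| <= K) -> (forall s, 0 <= s -> `|s * g' s| <= K) ->
  (\int[G]_z (sqnorm (colv z) * g (ssq z))%:E =
   \int[G]_z (N%:R * g (ssq z) + 2 * (ssq z * g' (ssq z)))%:E)%E.
Proof.
move=> mg mg' dg cg' gK g'K.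
have K0 : 0 <= K by exact: le_trans (gK 0 (lexx _)).
have mS : measurable_fun setT (fun z : N.-tuple R => ssq z).
  by apply: measurable_funM => //; exact: measurable_sqnorm.
have mt j : measurable_fun setT (fun z : N.-tuple R => tnth z j) by exact: measurable_tnth.
pose f j (z : N.-tuple R) := tnth z j * g (ssq z).
pose f' j (z : N.-tuple R) := g (ssq z) + 2 * (v * tnth z j ^+ 2 * g' (ssq z)).
have mf j : measurable_fun setT (f j).
  by apply: measurable_funM => //; exact: measurableT_comp.
have mf' j : measurable_fun setT (f' j).
  apply: measurable_funD; first exact: measurableT_comp.
  apply: measurable_funM => //; apply: measurable_funM; last exact: measurableT_comp.
  by apply: measurable_funM => //; exact: measurable_funX.
have fK j z : `|f j z| <= 3 * K * (1 + `|tnth z j|).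
  rewrite /f normrM; have := gK _ (ssq_ge0 z).
  have := normr_ge0 (tnth z j); have := normr_ge0 (g (ssq z)).
  move: `|g _| `|tnth z j| => a b a0 b0 aK.
  have : b * a <= b * K by rewrite ler_wpM2l.
  have : b * K <= 3 * K * (1 + b) by nra.
  lra.
have f'K j z : `|f' j z| <= 3 * K.
  have h : `|v * tnth z j ^+ 2 * g' (ssq z)| <= K.
    apply: le_trans (g'K _ (ssq_ge0 z)).
    rewrite !(normrM _ (g' _)) ler_wpM2r//.
    rewrite (ger0_norm (ssq_ge0 z)) (@ger0_norm _ (v * tnth z j ^+ 2)); last first.
      by rewrite mulr_ge0 ?sqr_ge0// ltW.
    by rewrite ler_pM2l// tnth_sqr_le.
  apply: (le_trans (ler_normD _ _)); rewrite (normrM 2) (@ger0_norm _ 2)//.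
  by have := gK _ (ssq_ge0 z); lra.
have if1 j : G.-integrable setT (EFin \o (fun z => tnth z j * f j z)).
  have := @integrable_gauss_stein R N (fun=> 0) (fun=> 1) j _ _ (oner_neq0 _) (mf j) (fK j).
  by apply: eq_integrable => // z _; rewrite /= subr0.
have if2 j : G.-integrable setT (EFin \o (f' j)) by exact: (@integrable_bounded _ _ _ G _ _ (mf' j) (f'K j)).
transitivity (\int[G]_z (\sum_j tnth z j * f j z)%:E)%E.
  apply: eq_integral => z _; rewrite sqnorm_colv mulr_suml; congr (_ %:E).
  by apply: eq_bigr => j _; rewrite /f mulrA expr2 sqnorm_colv.
transitivity (\int[G]_z (\sum_j f' j z)%:E)%E; last first.
  apply: eq_integral => z _; rewrite big_split/= sumr_const card_ord mulr_natl; congr (_ + _)%:E.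
  by rewrite -mulr_sumr -mulr_suml -mulr_sumr -sqnorm_colv.
rewrite !integral_bigsum//; apply: eq_bigr => j _.
transitivity (\int[G]_z ((tnth z j - 0) * f j z)%:E)%E.
  by apply: eq_integral => z _; rewrite subr0.
transitivity (\int[G]_z (1 ^+ 2 * f' j z)%:E)%E; last first.
  by apply: eq_integral => z _; rewrite expr1n mul1r.
apply: (@stein_gauss R N (fun=> 0) (fun=> 1) j (f j) (f' j) (3 * K) (oner_neq0 _)
   (mf j) (mf' j) _ _ (fK j) (f'K j)).
- move=> z y; rewrite /f /f'.
  set b := \sum_(i | i != j) tnth z i ^+ 2.
  have b0 : 0 <= b by apply: sumr_ge0 => i _; exact: sqr_ge0.
  have sge (u : R) : 0 <= v * (u ^+ 2 + b).
    by rewrite mulr_ge0 ?addr_ge0 ?sqr_ge0// ltW.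
  rewrite !sqnorm_upd !tnth_upd eqxx -/b.
  have -> : (fun u : R => tnth (upd z j u) j * g (ssq (upd z j u))) =
            (fun u => u * g (v * (u ^+ 2 + b))).
    by apply/funext => u; rewrite sqnorm_upd tnth_upd eqxx.
  have dg1 := dg _ (sge y).
  have dq : is_derive y (1 : R) (fun u : R => v * (u ^+ 2 + b)) (v * (2 * y)).
    apply: is_derive_eq; rewrite /GRing.scale/= ; ring.
  have dgq : is_derive y (1 : R) (fun u : R => g (v * (u ^+ 2 + b)))
      (g' (v * (y ^+ 2 + b)) * (v * (2 * y))).
    exact: (@is_derive1_comp _ g (fun u : R => v * (u ^+ 2 + b)) y).
  apply: is_derive_eq; rewrite /GRing.scale/=; ring.
- move=> z y; rewrite /f'.
  set b := \sum_(i | i != j) tnth z i ^+ 2.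
  have b0 : 0 <= b by apply: sumr_ge0 => i _; exact: sqr_ge0.
  have -> : (fun u : R => g (ssq (upd z j u)) +
       2 * (v * tnth (upd z j u) j ^+ 2 * g' (ssq (upd z j u)))) =
     (fun u : R => g (v * (u ^+ 2 + b)) + 2 * (v * u ^+ 2 * g' (v * (u ^+ 2 + b)))).
    by apply/funext => u; rewrite sqnorm_upd tnth_upd eqxx.
  have sge : 0 <= v * (y ^+ 2 + b).
    by rewrite mulr_ge0 ?addr_ge0 ?sqr_ge0// ltW.
  have cq2 : {for y, continuous (fun u : R => u ^+ 2)} by exact: exprn_continuous.
  have cq : {for y, continuous (fun u : R => v * (u ^+ 2 + b))}.
    apply: cvgM; first exact: cvg_cst.
    by apply: cvgD; [exact: cq2|exact: cvg_cst].
  have cgq : {for y, continuous (fun u : R => g (v * (u ^+ 2 + b)))}.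
    apply: (@continuous_comp _ _ _ (fun u : R => v * (u ^+ 2 + b)) g) => //.
    exact: is_derive_continuous (dg _ sge).
  have cg'q : {for y, continuous (fun u : R => g' (v * (u ^+ 2 + b)))}.
    apply: (@continuous_comp _ _ _ (fun u : R => v * (u ^+ 2 + b)) g') => //.
    exact: cg' _ sge.
  apply: cvgD; first exact: cgq.
  apply: cvgM; first exact: cvg_cst.
  apply: cvgM; last exact: cg'q.
  by apply: cvgM; [exact: cvg_cst|exact: cq2].
Qed.

End chi.

(** The inverse is discontinuous at 0, so it is written as x times a power of x^2; at x = 0 both
    sides are 0. *)
Lemma measurable_inv (R : realType) : measurable_fun [set: R] (@GRing.inv R).
Proof.
rewrite (_ : GRing.inv = fun x : R => x * (x ^+ 2) `^ (-1)); last first.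
  apply/funext => x; rewrite powR_inv1 ?sqr_ge0//.
  have [->|x0] := eqVneq x 0; first by rewrite invr0 mul0r.
  by field.
apply: measurable_funM => //.
apply: (@measurableT_comp _ _ _ _ _ _ (@powR R ^~ (-1))) => //.
Qed.

Lemma measurable_funV d (T : measurableType d) (R : realType) (f : T -> R) :
  measurable_fun setT f -> measurable_fun setT (fun x => (f x)^-1).
Proof. by move=> mf; apply: measurableT_comp mf; exact: measurable_inv. Qed.

Section chi_product.
Context (R : realType) (N : nat) (v : R).
Hypothesis v0 : 0 < v.
Context d' (T' : measurableType d') (kappa : probability T' R).
Local Notation G := (@gauss R N (fun=> 0) (fun=> 1)).
Local Notation M := (kappa \x G)%E.
Local Notation ssq z := (v * sqnorm (colv z)).
Variables (g g' : T' -> R -> R) (K : R).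
Hypotheses (mg : measurable_fun setT (fun p : T' * R => g p.1 p.2))
  (mg' : measurable_fun setT (fun p : T' * R => g' p.1 p.2))
  (dg : forall t (s : R), 0 <= s -> is_derive s 1 (g t) (g' t s))
  (cg' : forall t (s : R), 0 <= s -> {for s, continuous (g' t)})
  (gK : forall t s, 0 <= s -> `|g t s| <= K)
  (g'K : forall t s, 0 <= s -> `|s * g' t s| <= K).

Let mS : measurable_fun setT (fun w : T' * N.-tuple R => (w.1, ssq w.2)).
Proof.
apply: measurable_fun_pair => //; apply: measurable_funM => //.
by apply: (measurableT_comp (@measurable_sqnorm R N)).
Qed.

Let mQ : measurable_fun setT (fun w : T' * N.-tuple R => sqnorm (colv w.2)).
Proof. by apply: (measurableT_comp (@measurable_sqnorm R N)). Qed.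

Let mgS : measurable_fun setT (fun w : T' * N.-tuple R => g w.1 (ssq w.2)).
Proof. exact: (measurableT_comp mg mS). Qed.

Let mg'S : measurable_fun setT (fun w : T' * N.-tuple R => ssq w.2 * g' w.1 (ssq w.2)).
Proof.
apply: measurable_funM; last exact: (measurableT_comp mg' mS).
by apply: measurable_funM.
Qed.

Lemma integrable_snd_sqnorm : M.-integrable setT (EFin \o (fun w => sqnorm (colv w.2))).
Proof.
have mq : measurable_fun setT (EFin \o (fun z : N.-tuple R => sqnorm (colv z))).
  by apply/measurable_EFinP; exact: measurable_sqnorm.
have H := integrable_lawP measurable_snd (@law_snd _ _ _ _ _ kappa G) mq.
exact: H.2 (integrable_gauss_sqnorm _ _).
Qed.

Lemma integrable_chi1 :
  M.-integrable setT (EFin \o (fun w => sqnorm (colv w.2) * g w.1 (ssq w.2))).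
Proof.
apply: (@integrable_le_integrable _ _ _ M _ (fun w => K * sqnorm (colv w.2))).
- exact: measurable_funM.
- move=> w; rewrite normrM mulrC (ger0_norm (sqnorm_ge0 _)).
  by rewrite ler_wpM2r ?sqnorm_ge0// gK// ssq_ge0.
- by apply: integrable_scale; exact: integrable_snd_sqnorm.
Qed.

Lemma integrable_chi_g : M.-integrable setT (EFin \o (fun w => g w.1 (ssq w.2))).
Proof.
apply: (@integrable_bounded _ _ _ M _ K) => // w.
by rewrite gK// ssq_ge0.
Qed.

Lemma integrable_chi_deriv :
  M.-integrable setT (EFin \o (fun w => ssq w.2 * g' w.1 (ssq w.2))).
Proof.
apply: (@integrable_bounded _ _ _ M _ K) => // w.
by rewrite g'K// ssq_ge0.
Qed.

Lemma integrable_chi2 : M.-integrable setT (EFin \o (fun w =>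
  N%:R * g w.1 (ssq w.2) + 2 * (ssq w.2 * g' w.1 (ssq w.2)))).
Proof.
apply: integrable_add; apply: integrable_scale.
  exact: integrable_chi_g.
exact: integrable_chi_deriv.
Qed.

(** The parameter [t] will be the pair (V, Vs). With [t] frozen this is the chi-square identity; the
    bound [K], uniform in [t], lets it be integrated. *)
Lemma chi_product :
  (\int[M]_w (sqnorm (colv w.2) * g w.1 (ssq w.2))%:E =
   \int[M]_w (N%:R * g w.1 (ssq w.2) + 2 * (ssq w.2 * g' w.1 (ssq w.2)))%:E)%E.
Proof.
apply: eq_integral_fubini1; [exact: integrable_chi1|exact: integrable_chi2|].
move=> t /=.
have mt : measurable_fun setT (fun s : R => (t, s)) by exact: measurable_fun_pair.
apply: (@chi_gauss R N v v0 (g t) (g' t) K) => //; [| |exact: cg'|exact: gK|exact: g'K].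
- exact: (measurableT_comp mg mt).
- exact: (measurableT_comp mg' mt).
Qed.

End chi_product.

(* The chi-square identity for [g n], where [s * g n s <= 1] and
   [`|s * g' n s| <= 1], bounds the mean of [g n] by 3 uniformly in [n]. *)
Section log.
Context (R : realType) (N : nat).
Hypothesis N0 : (0 < N)%N.
Local Notation G := (@gauss R N (fun=> 0) (fun=> 1)).

Let eps (n : nat) : R := n.+1%:R^-1.
Let eps0 n : 0 < eps n. Proof. by rewrite invr_gt0. Qed.
Let eps1 n : eps n <= 1. Proof. by rewrite invf_le1// ler1n. Qed.
(** A regularization of - ln s that is smooth at s = 0. Adding ln (1 + s) makes it nonnegative, as
    eps <= 1, and small at infinity; it increases with [n]. *)
Let g n (s : R) := ln (1 + s) - ln (s + eps n).
Let g' n (s : R) := (1 + s)^-1 - (s + eps n)^-1.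

Let g_ge0 n s : 0 <= s -> 0 <= g n s.
Proof.
move=> s0; have e0 := eps0 n; have e1 := eps1 n.
rewrite subr_ge0 ler_ln ?posrE; lra.
Qed.

Let mg n : measurable_fun setT (g n).
Proof.
apply: measurable_funB; apply: measurableT_comp => //; exact: measurable_funD.
Qed.

Let sg'_le n s : 0 <= s -> `|s * g' n s| <= 1.
Proof.
move=> s0; have e0 := eps0 n; have e1 := eps1 n.
have h1 : 0 <= s / (1 + s) <= 1.
  by rewrite divr_ge0 ?ler_pdivrMr ?mul1r; lra.
have h2 : 0 <= s / (s + eps n) <= 1.
  by rewrite divr_ge0 ?ler_pdivrMr ?mul1r; lra.
rewrite /g' mulrBr ler_norml; lra.
Qed.

Let sg_le n s : 0 <= s -> s * g n s <= 1.
Proof.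
move=> s0; have e0 := eps0 n; have e1 := eps1 n.
have p1 : 0 < 1 + s by lra.
have p2 : 0 < s + eps n by lra.
have h : g n s <= (1 - eps n) / (s + eps n).
  rewrite /g -ln_div ?posrE//.
  rewrite (_ : (1 + s) / (s + eps n) = 1 + (1 - eps n) / (s + eps n)); last first.
    by field; rewrite gt_eqF.
  apply: le_ln1Dx; apply: (@lt_le_trans _ _ 0); first by lra.
  by rewrite divr_ge0//; lra.
apply: (le_trans (ler_wpM2l s0 h)).
rewrite mulrA ler_pdivrMr//; nra.
Qed.

Let integral_g_le n : (\int[G]_z (g n (sqnorm (colv z)))%:E <= 3%:E)%E.
Proof.
(* This bound depends on [n], which is harmless: it only licenses the identity and does not enter
   the final constant. *)
pose K := 1 - ln (eps n).
have K1 : 1 <= K by rewrite lerDl oppr_ge0 ln_le0.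
have gK s : 0 <= s -> `|g n s| <= K.
  move=> s0; have e0 := eps0 n; have e1 := eps1 n.
  rewrite ger0_norm ?g_ge0// /g lerBlDr.
  rewrite (_ : K + _ = 1 + (ln (s + eps n) - ln (eps n))); last by rewrite /K; ring.
  have p1 : 0 < 1 + s by lra.
  have p2 : 0 < s + eps n by lra.
  rewrite -ln_div ?posrE//.
  apply: (@le_trans _ _ (ln ((s + eps n) / eps n))); last by rewrite lerDr.
  rewrite ler_ln ?posrE ?divr_gt0// ler_pdivlMr//.
  have : s * eps n <= s by rewrite ler_piMr.
  lra.
have mg' : measurable_fun setT (g' n).
  by apply: measurable_funB; apply: measurable_funV; exact: measurable_funD.
have mS := measurable_sqnorm (R := R) (n := N).
have ig : G.-integrable setT (EFin \o (fun z => g n (sqnorm (colv z)))).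
  apply: (@integrable_bounded _ _ _ G _ K); first exact: measurableT_comp.
  by move=> z; rewrite gK// sqnorm_ge0.
have ig' : G.-integrable setT (EFin \o (fun z => sqnorm (colv z) * g' n (sqnorm (colv z)))).
  apply: (@integrable_bounded _ _ _ G _ 1).
    by apply: measurable_funM => //; exact: measurableT_comp.
  by move=> z; rewrite sg'_le// sqnorm_ge0.
have isg : G.-integrable setT (EFin \o (fun z => sqnorm (colv z) * g n (sqnorm (colv z)))).
  apply: (@integrable_bounded _ _ _ G _ 1).
    by apply: measurable_funM => //; exact: measurableT_comp.
  move=> z; rewrite ger0_norm ?sg_le ?mulr_ge0 ?g_ge0 ?sqnorm_ge0//.
have dg (s : R) : 0 <= s -> is_derive s 1 (g n) (g' n s).
  move=> s0; have p1 : 0 < 1 + s by rewrite ltr_pwDl.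
  have p2 : 0 < s + eps n by rewrite ltr_wpDl.
  have d1 : is_derive s (1 : R) (fun u : R => ln (1 + u)) ((1 + s)^-1 * 1).
    apply: (@is_derive1_comp _ (@ln R) (fun u : R => 1 + u) s) => //.
      exact: is_derive1_ln.
    by rewrite -[X in is_derive _ _ _ X]add0r; exact: is_deriveD.
  have d2 : is_derive s (1 : R) (fun u : R => ln (u + eps n)) ((s + eps n)^-1 * 1).
    apply: (@is_derive1_comp _ (@ln R) (fun u : R => u + eps n) s) => //.
      exact: is_derive1_ln.
    by rewrite -[X in is_derive _ _ _ X]addr0; exact: is_deriveD.
  by apply: is_derive_eq; rewrite !mulr1.
have cg' (s : R) : 0 <= s -> {for s, continuous (g' n)}.
  move=> s0; have p1 : 0 < 1 + s by rewrite ltr_pwDl.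
  have p2 : 0 < s + eps n by rewrite ltr_wpDl.
  apply: cvgB; apply: cvgV; rewrite ?gt_eqF//; apply: cvgD; by [exact: cvg_cst|exact: cvg_id].
have H := @chi_gauss R N 1 ltr01 (g n) (g' n) K (mg n) mg' dg cg' gK
  (fun s s0 => le_trans (sg'_le n s0) K1).
have {}H : (\int[G]_z (sqnorm (colv z) * g n (sqnorm (colv z)))%:E =
   \int[G]_z (N%:R * g n (sqnorm (colv z)) +
      2 * (sqnorm (colv z) * g' n (sqnorm (colv z))))%:E)%E.
  rewrite [LHS](eq_integral (fun z : N.-tuple R =>
     (sqnorm (colv z) * g n (1 * sqnorm (colv z)))%:E)); last by move=> z _; rewrite mul1r.
  by rewrite H; apply: eq_integral => z _; rewrite !mul1r.
(* As N >= 1, the mean of g is at most N E[g], which the identity turns into E[s g - 2 s g'] <= 1 +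
   2. *)
apply: (@le_trans _ _ (\int[G]_z (N%:R * g n (sqnorm (colv z)))%:E)%E).
  apply: le_integral => //; first exact: integrable_scale.
  by move=> z _; rewrite lee_fin ler_peMl ?g_ge0 ?sqnorm_ge0// ler1n.
apply: (@le_trans _ _ (\int[G]_z (sqnorm (colv z) * g n (sqnorm (colv z)) -
    2 * (sqnorm (colv z) * g' n (sqnorm (colv z))))%:E)%E).
  under [leRHS]eq_integral do rewrite EFinB.
  rewrite integralB//; last exact: integrable_scale.
  rewrite H -integralB//; last 2 first.
  - by apply: integrable_add; apply: integrable_scale.
  - exact: integrable_scale.
  by rewrite le_eqVlt; apply/orP; left; apply/eqP; apply: eq_integral => z _; rewrite -EFinB addrK.
apply: (@le_trans _ _ (\int[G]_z 3%:E)%E).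
  apply: le_integral => //.
  - by apply: integrable_sub => //; exact: integrable_scale.
  - exact: finite_measure_integrable_cst.
  - move=> z _; rewrite lee_fin.
    have := sg_le n (sqnorm_ge0 (colv z)).
    by have := sg'_le n (sqnorm_ge0 (colv z)); rewrite ler_norml; lra.
by rewrite integral_cst// [X in (_ * X)%E](_ : _ = 1%E) ?mule1//; exact: probability_setT.
Qed.

(** Monotone convergence carries the uniform bound over to h = ln (1 + s) - ln s, and |ln s| <= h +
    s: the first term controls s < 1, the second s > 1. *)
Lemma integrable_ln_sqnorm :
  G.-integrable setT (EFin \o (fun z => ln (sqnorm (colv z)))).
Proof.
have mS := measurable_sqnorm (R := R) (n := N).
have mpos : measurable_fun setT (fun z : N.-tuple R => 0 < sqnorm (colv z)).
  exact: measurable_fun_ltr.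
(* At s = 0 the regularizations tend to infinity while [ln 0] is 0. Cutting off both [h] and [hn]
   there makes the convergence hold at every point. *)
pose h (z : N.-tuple R) : R :=
  if 0 < sqnorm (colv z) then ln (1 + sqnorm (colv z)) - ln (sqnorm (colv z)) else 0.
pose hn n (z : N.-tuple R) : R :=
  if 0 < sqnorm (colv z) then g n (sqnorm (colv z)) else 0.
have mh : measurable_fun setT h.
  apply: measurable_fun_ifT => //; apply: measurable_funB; apply: measurableT_comp => //.
  exact: measurable_funD.
have mhn n : measurable_fun setT (hn n).
  by apply: measurable_fun_ifT => //; exact: measurableT_comp.
have hn_ge0 n z : 0 <= hn n z.
  by rewrite /hn; case: ifPn => // _; rewrite g_ge0 ?sqnorm_ge0.
have h_ge0 z : 0 <= h z.
  rewrite /h; case: ifPn => // p; rewrite subr_ge0 ler_ln ?posrE//; lra.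
have hn_cvg z : hn n z @[n --> \oo] --> h z.
  rewrite /hn /h; case: ifPn => p; last exact: cvg_cst.
  apply: cvgB; first exact: cvg_cst.
  have e_cvg : sqnorm (colv z) + eps n @[n --> \oo] --> sqnorm (colv z).
    rewrite -[X in _ --> X]addr0; apply: cvgD; first exact: cvg_cst.
    exact: cvg_harmonic.
  exact: (cvg_comp _ _ e_cvg (continuous_ln p)).
have Ih : (\int[G]_z (h z)%:E <= 3%:E)%E.
  have -> : (\int[G]_z (h z)%:E = \int[G]_z limn (fun n => (hn n z)%:E))%E.
    apply: eq_integral => z _; apply/esym/cvg_lim => //.
    by apply/cvg_EFin; [near=> n|exact: hn_cvg].
  have nd z : {homo (fun n => (hn n z)%:E) : a b / (a <= b)%N >-> (a <= b)%E}.
    move=> a b ab; rewrite lee_fin /hn; case: ifPn => // p.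
    have := eps0 a; have := eps0 b => eb ea.
    rewrite lerB// ler_ln ?posrE ?addr_gt0// lerD2l.
    by rewrite lef_pV2 ?posrE// ler_nat.
  rewrite (@monotone_convergence _ _ _ G setT measurableT
    (fun n z => (hn n z)%:E)); [|by move=> n; exact/measurable_EFinP
      |by move=> n z _; rewrite lee_fin|by move=> z _; exact: nd].
  apply: lime_le.
    apply: ereal_nondecreasing_is_cvgn => a b ab.
    apply: ge0_le_integral => //; [by move=> z _; rewrite lee_fin
      |exact/measurable_EFinP|exact/measurable_EFinP|].
    by move=> z _; exact: nd.
  apply: nearW => n; apply: le_trans (integral_g_le n).
  apply: ge0_le_integral => //; [by move=> z _; rewrite lee_fin
    |exact/measurable_EFinP| |].
    by apply/measurable_EFinP; exact: measurableT_comp.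
  move=> z _; rewrite lee_fin /hn; case: ifPn => // _.
  by rewrite g_ge0 ?sqnorm_ge0.
have ih : G.-integrable setT (EFin \o h).
  apply/integrableP; split; first exact/measurable_EFinP.
  under eq_integral do rewrite /= ger0_norm//.
  by apply: (le_lt_trans Ih); rewrite ltry.
apply: (@integrable_le_integrable _ _ _ G _ (fun z => h z + sqnorm (colv z))).
- exact: measurableT_comp.
- move=> z; have s0 := sqnorm_ge0 (colv z).
  have := h_ge0 z; rewrite /h; case: ifPn => [p|]; last first.
    by rewrite -leNgt => sle0 _; rewrite ln0// normr0 add0r.
  have h1 : ln (1 + sqnorm (colv z)) <= sqnorm (colv z) by apply: le_ln1Dx; lra.
  have h2 : 0 <= ln (1 + sqnorm (colv z)) by apply: ln_ge0; lra.
  by move=> h3; rewrite ler_norml; lra.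
- by apply: integrable_add => //; exact: integrable_gauss_sqnorm.
Unshelve. all: by end_near. Qed.

End log.

(** * The inequality between the unbiased estimators of the risks *)

(** This is sinh t > t, by the mean value theorem: the derivative of the difference of the two sides
    is (e^u - 1)^2 / e^u. *)
Lemma expR_sub_expRN_gt (R : realType) (t : R) : 0 < t ->
  2 * t < expR t - expR (- t).
Proof.
move=> t0; pose k (u : R) := expR u - expR (- u) - 2 * u.
pose k' (u : R) := expR u + expR (- u) - 2.
have dk (u : R) : is_derive u (1 : R) k (k' u).
  have dN : is_derive u (1 : R) (fun u : R => expR (- u)) (expR (- u) * -1).
    by apply: (@is_derive1_comp _ (@expR R) (fun u : R => - u) u).
  by apply: is_derive_eq; rewrite /k' /GRing.scale/=; ring.
have [|c] := @MVT _ k k' _ _ t0 (fun u _ => dk u).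
  apply: continuous_subspaceT => u; exact: is_derive_continuous (dk u).
rewrite in_itv/= => /andP[c0 _]; rewrite {1 2}/k oppr0 expR0 addr0 => kt.
have : 0 < k' c * t.
  rewrite mulr_gt0// /k'.
  have e1 : 1 < expR c by rewrite expR_gt1.
  have e0 : 0 < expR c by exact: expR_gt0.
  rewrite expRN (_ : _ + _ - 2 = (expR c - 1) ^+ 2 / expR c); last by field; rewrite gt_eqF.
  by rewrite divr_gt0// exprn_gt0// subr_gt0.
by rewrite -kt; lra.
Qed.

(** At y = 1 / (1 - phi) the right-hand side is 2 phi + phi^2 / (1 - phi), which is the bound needed
    for - ln (1 - phi). *)
Lemma ln_lt_half_sub_inv (R : realType) (y : R) : 1 < y -> 2 * ln y < y - y^-1.
Proof.
move=> y1; have y0 : 0 < y by apply: lt_trans y1.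
have := expR_sub_expRN_gt (ln_gt0 y1).
by rewrite expRN lnK.
Qed.

(* The left-hand side divided by [phi], with the logarithm replaced by its upper
   bound, is affine in [A], so that only [A = 0] and [A = rmax * W] matter. *)
Lemma improvement_lt0 (R : realType) (nu W A sr rmax N m : R) :
  0 < nu -> 0 <= W -> 0 <= A -> A <= rmax * W ->
  0 < rmax -> rmax <= sr -> 0 < N -> 0 < m ->
  nu * (2 * rmax * (N + 2) + m) <= 4 * (sr - 2 * rmax + m / N) ->
  nu * m <= 4 * sr ->
  forall phi, phi = nu / (nu + 1 + W) ->
  - 2 * (phi * sr - 2 * phi ^+ 2 * A / nu) + N * (phi ^+ 2 * A)
  + 2 * (- (phi ^+ 2 * A) + 2 * A * W * phi ^+ 3 / nu)
  - m / N * (N * phi + 2 * (W * phi ^+ 2 / nu)) - m * ln (1 - phi) < 0.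
Proof.
move=> nu0 W0 A0 AW r0 rs N0 m0 h1 h3 phi phiD.
pose T := nu + 1 + W; have T0 : 0 < T by rewrite /T; lra.
have phi0 : 0 < phi by rewrite phiD divr_gt0.
have W1 : 0 < 1 + W by lra.
have Tn0 : nu + 1 + W != 0 by rewrite gt_eqF.
have Wn0 : 1 + W != 0 by rewrite gt_eqF.
have phiE : 1 - phi = ((nu + 1 + W) / (1 + W))^-1.
  by rewrite phiD; field; rewrite Tn0 Wn0.
(* A parametrization of W by the unit interval, in which phi = nu (1 - p) / (nu + 1). *)
pose p := W / T.
have p0 : 0 <= p by rewrite divr_ge0// ltW.
have p1 : p <= 1 by rewrite ler_pdivrMr// mul1r /T; lra.
have Tp : W = p * T by rewrite /p divfK ?gt_eqF.
have phiT : phi = nu / T by rewrite phiD.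
(* Here phi^2 / (1 - phi) = phi nu / (1 + W), and 1 / (1 + W) is weakened to 1 - p = (nu + 1) / T,
   so that the correction is linear in p. *)
have lnlt : - ln (1 - phi) < phi + phi * nu * (1 - p) / 2.
  have y1 : 1 < T / (1 + W) by rewrite ltr_pdivlMr// mul1r /T; lra.
  rewrite phiE lnV ?posrE ?divr_gt0// opprK.
  have := ln_lt_half_sub_inv y1.
  have -> : T / (1 + W) - (T / (1 + W))^-1 = 2 * phi + phi * nu / (1 + W).
    by rewrite phiD /T; field; rewrite Tn0 Wn0.
  have : phi * nu / (1 + W) <= phi * nu * (1 - p).
    rewrite ler_wpM2l//; first by rewrite ltW// mulr_gt0.
    rewrite (_ : 1 - p = (nu + 1) / T); last by rewrite /p /T; field; rewrite gt_eqF.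
    rewrite ler_pdivlMr// mulrC ler_pdivrMr// /T; nra.
  lra.
(* [kappa] collects the coefficients of A after division by phi, using phi = nu / T and W phi / nu =
   p. *)
pose kappa := (4 + (N - 2) * nu + 4 * nu * p) / T.
pose E a := - 2 * sr + a * kappa - 2 * m / N * p + m * nu * (1 - p) / 2.
have E0 : E 0 <= 0.
  rewrite /E mul0r.
  have h : 0 <= 2 * m / N * p by rewrite mulr_ge0// ltW// divr_gt0// mulr_gt0.
  have : m * nu * (1 - p) <= m * nu by rewrite ler_piMr//; [rewrite ltW// mulr_gt0|lra].
  by move: h3; rewrite mulrC; lra.
have E1 : E (rmax * W) <= 0.
  have -> : E (rmax * W) = - 2 * sr + rmax * p * (4 + (N - 2) * nu + 4 * nu * p)
      - 2 * m / N * p + m * nu * (1 - p) / 2.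
    by rewrite /E /kappa /p; field; rewrite ?gt_eqF.
  (* Replacing p^2 by p leaves an affine function of p. It is nonpositive by the condition from
     [nu1] taken with weight p and the one from [nu3] with weight 1 - p. *)
  have hp : rmax * nu * (p * p) <= rmax * nu * p.
    by rewrite ler_wpM2l// ?ler_piMr// ltW// mulr_gt0.
  have h1' : 0 <= p * (4 * (sr - 2 * rmax + m / N) - nu * (2 * rmax * (N + 2) + m)).
    by rewrite mulr_ge0// subr_ge0.
  have h3' : 0 <= (1 - p) * (4 * sr - nu * m) by rewrite mulr_ge0// subr_ge0.
  have -> : 2 * m / N * p = 2 * (m / N) * p by ring.
  have -> : rmax * p * (4 + (N - 2) * nu + 4 * nu * p) =
     4 * (rmax * p) + (N - 2) * (rmax * nu * p) + 4 * (rmax * nu * (p * p)) by ring.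
  have hm : 0 <= p * (nu * m) by rewrite mulr_ge0// ltW// mulr_gt0.
  move: h1' h3' hp; move: (m / N) => mN; nra.
have EA : E A <= 0.
  (* The slope in A can be negative, for instance when N = 1, nu > 4 and p is small; its sign
     decides which endpoint gives the maximum. *)
  have [k0|k0] := leP 0 kappa.
    apply: le_trans E1; rewrite /E.
    by have := ler_wpM2r k0 AW; lra.
  apply: le_trans E0; rewrite /E.
  have := ler_wnM2r (ltW k0) A0; lra.
apply: (@lt_le_trans _ _ (phi * E A)); last by rewrite pmulr_rle0.
have -> : phi * E A = - 2 * (phi * sr - 2 * phi ^+ 2 * A / nu) + N * (phi ^+ 2 * A)
  + 2 * (- (phi ^+ 2 * A) + 2 * A * W * phi ^+ 3 / nu)
  - m / N * (N * phi + 2 * (W * phi ^+ 2 / nu)) + m * (phi + phi * nu * (1 - p) / 2).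
  rewrite /E /kappa /p phiD /T; field.
  by rewrite Tn0 !gt_eqF.
by rewrite ltrD2l -mulrN ltr_pM2l.
Qed.

(** * The risk difference *)

Section stein_product.
Context (R : realType) (n : nat) (m s : 'I_n -> R) (i : 'I_n).
Context d1 d2 (T1 : measurableType d1) (T2 : measurableType d2)
  (k1 : probability T1 R) (k2 : probability T2 R).
Hypothesis s0 : s i != 0.
Local Notation G := (gauss m s).
Local Notation M1 := (G \x k1)%E.
Local Notation M := (M1 \x k2)%E.

Let h (x : n.-tuple R) : R := (1 + `|tnth x i|) ^+ 2.

Let mh : measurable_fun setT (EFin \o h).
Proof.
apply/measurable_EFinP; apply: measurable_funX; apply: measurable_funD => //.
by apply: measurableT_comp => //; exact: measurable_tnth.
Qed.

Let ih1 : M1.-integrable setT (EFin \o (fun w => h w.1)).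
Proof.
have H := integrable_lawP measurable_fst (@law_fst _ _ _ _ _ G k1) mh.
exact: H.2 (integrable_gauss_sqr _ s0).
Qed.

Lemma integrable_sqr_product : M.-integrable setT (EFin \o (fun w => (1 + `|tnth w.1.1 i|) ^+ 2)).
Proof.
have mh1 := measurable_int _ ih1.
have H := integrable_lawP measurable_fst (@law_fst _ _ _ _ _ M1 k2) mh1.
exact: H.2 ih1.
Qed.

Variables (f f' : (n.-tuple R * T1) * T2 -> R) (K : R).
Hypotheses (mf : measurable_fun setT f) (mf' : measurable_fun setT f').
Hypotheses (fK : forall w, `|f w| <= K * (1 + `|tnth w.1.1 i|))
  (f'K : forall w, `|f' w| <= K).
Hypothesis df : forall x t1 t2 (y : R),
  is_derive y 1 (fun y => f ((upd x i y, t1), t2)) (f' ((upd x i y, t1), t2)).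
Hypothesis cf' : forall x t1 t2, continuous (fun y => f' ((upd x i y, t1), t2)).

Let mx : measurable_fun setT (fun x : n.-tuple R => tnth x i - m i).
Proof. by apply: measurable_funB => //; exact: measurable_tnth. Qed.

Let bound w : `|(tnth w.1.1 i - m i) * f w| <= K * (1 + `|m i|) * h w.1.1.
Proof.
exact: stein_term_le.
Qed.

Lemma integrable_stein_product1 :
  M.-integrable setT (EFin \o (fun w => (tnth w.1.1 i - m i) * f w)).
Proof.
apply: (@integrable_le_integrable _ _ _ M _ _ _ bound).
- apply: measurable_funM => //; apply: (measurableT_comp mx).
  exact: measurableT_comp.
- by apply: integrable_scale; exact: integrable_sqr_product.
Qed.

Lemma integrable_stein_product2 :
  M.-integrable setT (EFin \o (fun w => s i ^+ 2 * f' w)).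
Proof.
by apply: integrable_scale; exact: (@integrable_bounded _ _ _ M _ K).
Qed.

(** Stein's identity in one coordinate of the first factor, with the two other factors frozen one
    after the other. *)
Lemma stein_product :
  (\int[M]_w ((tnth w.1.1 i - m i) * f w)%:E = \int[M]_w (s i ^+ 2 * f' w)%:E)%E.
Proof.
apply: eq_integral_fubini2;
  [exact: integrable_stein_product1|exact: integrable_stein_product2|].
move=> t2 /=.
have m2 : measurable_fun setT (fun y : n.-tuple R * T1 => (y, t2)).
  exact: measurable_fun_pair.
apply: eq_integral_fubini2.
- apply: (@integrable_le_integrable _ _ _ M1 _ _ _ (fun y => bound (y, t2))).
    apply: measurable_funM; last exact: (measurableT_comp mf m2).
    apply: (measurableT_comp mx); exact: measurable_fst.
  by apply: integrable_scale.
- apply: integrable_scale; apply: (@integrable_bounded _ _ _ M1 _ K).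
    exact: (measurableT_comp mf' m2).
  by move=> y; exact: f'K.
move=> t1 /=.
have m1 : measurable_fun setT (fun y : n.-tuple R => ((y, t1), t2)).
  by apply: measurable_fun_pair => //; exact: measurable_fun_pair.
apply: (@stein_gauss R n m s i (fun x => f ((x, t1), t2))
  (fun x => f' ((x, t1), t2)) K s0).
- exact: (measurableT_comp mf m1).
- exact: (measurableT_comp mf' m1).
- by move=> x; exact: cf'.
- by move=> x; exact: fK.
- by move=> x; exact: f'K.
Qed.

End stein_product.

Section same_mean.
Context d (T : measurableType d) (R : realType) (P : {measure set T -> \bar R}).

(** Integrability is bundled with the equality because extended integrals add up only for integrable
    functions; the relation is then stable under sums and scaling. *)
Definition same_mean (f g : T -> R) : Prop :=
  [/\ P.-integrable setT (EFin \o f), P.-integrable setT (EFin \o g) &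
      (\int[P]_x (f x)%:E = \int[P]_x (g x)%:E)%E].

Lemma same_mean_refl f : P.-integrable setT (EFin \o f) -> same_mean f f.
Proof. by []. Qed.

Lemma same_mean_add f g f' g' : same_mean f f' -> same_mean g g' ->
  same_mean (fun x => f x + g x) (fun x => f' x + g' x).
Proof.
move=> [i1 i2 e1] [i3 i4 e2]; split; [exact: integrable_add|exact: integrable_add|].
under eq_integral do rewrite EFinD.
under [RHS]eq_integral do rewrite EFinD.
by rewrite !integralD_EFin// e1 e2.
Qed.

Lemma same_mean_scale k f f' : same_mean f f' ->
  same_mean (fun x => k * f x) (fun x => k * f' x).
Proof.
move=> [i1 i2 e1]; split; [exact: integrable_scale|exact: integrable_scale|].
under eq_integral do rewrite EFinM.
under [RHS]eq_integral do rewrite EFinM.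
by rewrite !integralZl// e1.
Qed.

Lemma same_mean_sum (I : Type) (r : seq I) (f f' : I -> T -> R) :
  (forall i, same_mean (f i) (f' i)) ->
  same_mean (fun x => \sum_(i <- r) f i x) (fun x => \sum_(i <- r) f' i x).
Proof.
move=> ff'; have i1 i : P.-integrable setT (EFin \o f i) by case: (ff' i).
have i2 i : P.-integrable setT (EFin \o f' i) by case: (ff' i).
split; [exact: integrable_bigsum|exact: integrable_bigsum|].
by rewrite !integral_bigsum//; apply: eq_bigr => i _; case: (ff' i).
Qed.

End same_mean.

(** * The shrinkage factor and the identities applied to it *)

Section shrinkage.
Context (R : realType) (l q N : nat).
Variables (c d : 'I_l -> R) (gamma nu sigma2 m rmax : R) (theta : 'I_l -> R)
  (kappa : probability (q.-tuple R) R).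
Hypotheses (c0 : forall i, 0 < c i) (d0 : forall i, 0 < d i) (gamma0 : 0 < gamma)
  (nu0 : 0 < nu) (sigma20 : 0 < sigma2)
  (rmax_ge : forall i, d i / c i <= rmax) (rmax0 : 0 < rmax).

Local Notation G := (gauss theta (fun i => Num.sqrt (sigma2 * d i))).
Local Notation M1 := (G \x kappa)%E.
Local Notation Z := (@gauss R N (fun=> 0) (fun=> 1)).
Local Notation M := (M1 \x Z)%E.
Local Notation Y := (l.-tuple R * q.-tuple R)%type.

(** The numerators are separated from S so that S can vary on its own: W is [qW y / s] and A is
    [qA y / s]. Here [y] is the pair (V, Vs), and [kappa] stands for the law of Vs. *)
Definition qW (y : Y) : R :=
  \sum_i (c i * d i)^-1 * tnth y.1 i ^+ 2 + sqnorm (colv y.2) / gamma.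

Definition qA (y : Y) : R := \sum_i (c i)^-1 ^+ 2 * tnth y.1 i ^+ 2.

Definition shrink (w s : R) : R := nu / (nu + 1 + w / s).

Let b0 i : 0 < (c i * d i)^-1. Proof. by rewrite invr_gt0 mulr_gt0. Qed.

Let sqn_ge0 (y : Y) : 0 <= sqnorm (colv y.2) / gamma.
Proof. by rewrite divr_ge0 ?sqnorm_ge0// ltW. Qed.

Lemma qW_ge0 y : 0 <= qW y.
Proof.
rewrite addr_ge0//; apply: sumr_ge0 => i _.
by rewrite mulr_ge0 ?sqr_ge0// ltW.
Qed.

Lemma qA_ge0 y : 0 <= qA y.
Proof. by apply: sumr_ge0 => i _; rewrite mulr_ge0 ?sqr_ge0. Qed.

Lemma qW_term_le y i : (c i * d i)^-1 * tnth y.1 i ^+ 2 <= qW y.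
Proof.
rewrite /qW (bigD1 i)//= -addrA lerDl addr_ge0//.
by apply: sumr_ge0 => j _; rewrite mulr_ge0 ?sqr_ge0// ltW.
Qed.

(** Termwise, 1 / c_i^2 = (d_i / c_i) / (c_i d_i); the Vs part of [qW] only enlarges the right-hand
    side. *)
Lemma qA_le y : qA y <= rmax * qW y.
Proof.
rewrite /qW mulrDr.
apply: (@le_trans _ _ (rmax * \sum_i (c i * d i)^-1 * tnth y.1 i ^+ 2)).
  rewrite mulr_sumr; apply: ler_sum => i _.
  rewrite [leRHS]mulrA ler_wpM2r ?sqr_ge0//.
  have -> : (c i)^-1 ^+ 2 = d i / c i * (c i * d i)^-1.
    by field; rewrite !gt_eqF.
  by rewrite ler_wpM2r// ltW.
by rewrite lerDl mulr_ge0// ltW.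
Qed.

Lemma shrink_gt0 w s : 0 <= w -> 0 <= s -> 0 < shrink w s.
Proof.
move=> w0 s0; have h : 0 <= w / s by rewrite divr_ge0.
by rewrite divr_gt0//; move: nu0; lra.
Qed.

(** Keeps 1 - phi above 1 / (nu + 1), also at s = 0, where w / s is 0 by convention. *)
Lemma shrink_le w s : 0 <= w -> 0 <= s -> shrink w s <= nu / (nu + 1).
Proof.
move=> w0 s0; have h : 0 <= w / s by rewrite divr_ge0.
have n0 := nu0; have p1 : 0 < nu + 1 by lra.
have p2 : 0 < nu + 1 + w / s by lra.
by rewrite /shrink ler_pM2l// lef_pV2 ?posrE// lerDl.
Qed.

Lemma shrink_lt1 w s : 0 <= w -> 0 <= s -> shrink w s < 1.
Proof.
move=> w0 s0; apply: (le_lt_trans (shrink_le w0 s0)).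
have n0 := nu0; have p1 : 0 < nu + 1 by lra.
by rewrite ltr_pdivrMr// mul1r; lra.
Qed.

Lemma shrink_mul_le w s : 0 <= w -> 0 <= s -> shrink w s * (w / s) <= nu.
Proof.
move=> w0 s0; have h : 0 <= w / s by rewrite divr_ge0.
have n0 := nu0; rewrite /shrink mulrAC ler_pdivrMr; last lra.
by rewrite ler_pM2l//; lra.
Qed.

Lemma measurable_qW : measurable_fun setT qW.
Proof.
apply: measurable_funD.
  apply: measurable_sum => i; apply: measurable_funM => //; apply: measurable_funX.
  by apply: (measurableT_comp (measurable_tnth i)).
apply: measurable_funM => //.
exact: (measurableT_comp (@measurable_sqnorm R q) measurable_snd).
Qed.

Lemma measurable_qA : measurable_fun setT qA.
Proof.
apply: measurable_sum => i; apply: measurable_funM => //; apply: measurable_funX.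
by apply: (measurableT_comp (measurable_tnth i)).
Qed.

Section measurable_data.
Context dT (T : measurableType dT) (y : T -> Y) (s : T -> R).
Hypotheses (my : measurable_fun setT y) (ms : measurable_fun setT s).

Lemma measurable_shrink : measurable_fun setT (fun t => shrink (qW (y t)) (s t)).
Proof.
apply: measurable_funM => //; apply: measurable_funV; apply: measurable_funD => //.
apply: measurable_funM; first exact: (measurableT_comp measurable_qW my).
exact: measurable_funV.
Qed.

End measurable_data.

(* Set to 0 at [s = 0], where [shrink _ 0] takes the junk value [nu / (nu + 1)]. *)
Definition shrinkV i (w : Y * N.-tuple R) : R :=
  let s := sigma2 * sqnorm (colv w.2) in
  if 0 < s then shrink (qW w.1) s * tnth w.1.1 i else 0.

(** The partial derivative of [shrinkV i] in V_i, from the derivative - phi^2 / (nu s) of phi with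
    respect to the numerator of W. *)
Definition shrinkV' i (w : Y * N.-tuple R) : R :=
  let s := sigma2 * sqnorm (colv w.2) in
  if 0 < s then shrink (qW w.1) s -
    2 * shrink (qW w.1) s ^+ 2 * ((c i * d i)^-1 * tnth w.1.1 i ^+ 2) / (nu * s)
  else 0.

Lemma qW_upd (v : l.-tuple R) (u : q.-tuple R) i t :
  qW (upd v i t, u) = (c i * d i)^-1 * t ^+ 2 +
    (\sum_(j | j != i) (c j * d j)^-1 * tnth v j ^+ 2 + sqnorm (colv u) / gamma).
Proof.
rewrite /qW (bigD1 i)//= tnth_upd eqxx addrA; congr (_ + _ + _).
by apply: eq_bigr => j ji; rewrite tnth_upd (negbTE ji).
Qed.

Let ms : measurable_fun setT (fun w : Y * N.-tuple R => sigma2 * sqnorm (colv w.2)).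
Proof.
apply: measurable_funM => //.
exact: (measurableT_comp (@measurable_sqnorm R N) measurable_snd).
Qed.

Let mv i : measurable_fun setT (fun w : Y * N.-tuple R => tnth w.1.1 i).
Proof.
apply: (measurableT_comp (measurable_tnth i)).
exact: (measurableT_comp measurable_fst measurable_fst).
Qed.

Let msh : measurable_fun setT (fun w : Y * N.-tuple R =>
   shrink (qW w.1) (sigma2 * sqnorm (colv w.2))).
Proof. by apply: measurable_shrink. Qed.

Lemma measurable_shrinkV i : measurable_fun setT (shrinkV i).
Proof.
apply: measurable_fun_ifT => //; first exact: measurable_fun_ltr.
exact: measurable_funM.
Qed.

Lemma measurable_shrinkV' i : measurable_fun setT (shrinkV' i).
Proof.
apply: measurable_fun_ifT => //; first exact: measurable_fun_ltr.
apply: measurable_funB => //; apply: measurable_funM; last first.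
  by apply: measurable_funV; apply: measurable_funM.
apply: measurable_funM; first by apply: measurable_funM => //; exact: measurable_funX.
by apply: measurable_funM => //; exact: measurable_funX.
Qed.

Lemma same_mean_shrinkV i : same_mean M
  (fun w => (tnth w.1.1 i - theta i) * shrinkV i w)
  (fun w => sigma2 * d i * shrinkV' i w).
Proof.
have s0 : Num.sqrt (sigma2 * d i) != 0 by rewrite gt_eqF// sqrtr_gt0 mulr_gt0.
have s2 : Num.sqrt (sigma2 * d i) ^+ 2 = sigma2 * d i.
  by rewrite sqr_sqrtr// ltW// mulr_gt0.
(* One constant has to serve the function and its derivative. The function is at most |V_i| in
   absolute value; the derivative is phi minus a term between 0 and 2 phi, hence the 3. *)
have fK w : `|shrinkV i w| <= 3 * (1 + `|tnth w.1.1 i|).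
  rewrite /shrinkV; case: ifPn => [p|_]; last by rewrite normr0 mulr_ge0 ?addr_ge0.
  rewrite normrM ger0_norm ?ltW ?shrink_gt0 ?qW_ge0 ?(ltW p)//.
  have := shrink_lt1 (qW_ge0 w.1) (ltW p).
  have := shrink_gt0 (qW_ge0 w.1) (ltW p).
  have := normr_ge0 (tnth w.1.1 i).
  set a := shrink _ _; set x := `|_| => x0 a0 a1.
  have : a * x <= x by rewrite ler_piMl// ltW.
  lra.
have f'K w : `|shrinkV' i w| <= 3.
  rewrite /shrinkV'; case: ifPn => [p|_]; last by rewrite normr0.
  set s := sigma2 * _ in p *; set t := (c i * d i)^-1 * _.
  have t0 : 0 <= t by rewrite mulr_ge0 ?sqr_ge0// ltW.
  have tw : t <= qW w.1 by exact: qW_term_le.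
  have phi1 := shrink_lt1 (qW_ge0 w.1) (ltW p).
  have phi0 := shrink_gt0 (qW_ge0 w.1) (ltW p).
  have phinu := shrink_mul_le (qW_ge0 w.1) (ltW p).
  move: phi1 phi0 phinu; set phi := shrink _ _ => phi1 phi0 phinu.
  have ht : 0 <= 2 * phi ^+ 2 * t / (nu * s).
    rewrite divr_ge0//; last by rewrite ltW// mulr_gt0.
    by rewrite mulr_ge0// mulr_ge0 ?sqr_ge0.
  have ht2 : 2 * phi ^+ 2 * t / (nu * s) <= 2 * phi.
    rewrite (_ : _ / _ = 2 * phi * (phi * (t / s) / nu)); last first.
      by field; rewrite !gt_eqF.
    apply: ler_piMr; first by rewrite mulr_ge0// ltW.
    rewrite ler_pdivrMr// mul1r.
    apply: le_trans phinu; rewrite ler_pM2l//.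
    by rewrite ler_pM2r// invr_gt0.
  by rewrite ler_norml; lra.
(* The test for s > 0 depends on [z] only, so each branch is differentiated on its own. *)
have df v u z (y : R) : is_derive y (1 : R)
    (fun y => shrinkV i ((upd v i y, u), z)) (shrinkV' i ((upd v i y, u), z)).
  rewrite /shrinkV /shrinkV' /=; case: ifPn => p; last first.
    exact: is_derive_cst.
  set s := sigma2 * _ in p *; set e := (c i * d i)^-1.
  have e0 : 0 <= e by exact: ltW (b0 i).
  set b := \sum_(j | j != i) (c j * d j)^-1 * tnth v j ^+ 2 + sqnorm (colv u) / gamma.
  have b_ge0 : 0 <= b.
    rewrite addr_ge0 ?(sqn_ge0 (v, u))//; apply: sumr_ge0 => j _.
    by rewrite mulr_ge0 ?sqr_ge0// ltW.
  have -> : (fun t => shrink (qW (upd v i t, u)) s * tnth (upd v i t) i) =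
      (fun t : R => nu * (nu + 1 + (e * t ^+ 2 + b) / s)^-1 * t).
    by apply/funext => t; rewrite qW_upd tnth_upd eqxx.
  have den : 0 < nu + 1 + (e * y ^+ 2 + b) / s.
    have : 0 <= (e * y ^+ 2 + b) / s.
      by apply: divr_ge0; [apply: addr_ge0 => //; apply: mulr_ge0 => //; exact: sqr_ge0|exact: ltW].
    by move: nu0; lra.
  have den2 : (nu + 1) * s + (e * y ^+ 2 + b) != 0.
    have h : 0 <= e * y ^+ 2 + b.
      by apply: addr_ge0 => //; apply: mulr_ge0 => //; exact: sqr_ge0.
    have n0 : 0 < nu + 1 by move: nu0; lra.
    by rewrite gt_eqF// ltr_pwDl// mulr_gt0.
  rewrite qW_upd tnth_upd eqxx -/e -/b /shrink.
  have dV : is_derive y (1 : R) (fun t : R => (nu + 1 + (e * t ^+ 2 + b) / s)^-1)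
      (- (nu + 1 + (e * y ^+ 2 + b) / s) ^- 2 * (e * (2 * y) / s)).
    apply: is_derive_eq; first by apply: is_deriveV; rewrite gt_eqF.
    by rewrite /GRing.scale/=; field; rewrite den2 gt_eqF.
  apply: is_derive_eq.
  rewrite /GRing.scale/=; field.
  by rewrite den2 !gt_eqF.
have cf' v u z : continuous (fun y => shrinkV' i ((upd v i y, u), z)).
  have [p|p] := boolP (0 < sigma2 * sqnorm (colv z)); last first.
    rewrite (_ : (fun y => _) = cst 0); first exact: cst_continuous.
    by apply/funext => y; rewrite /shrinkV' /= (negbTE p).
  move=> y; rewrite /shrinkV' /= p.
  set s := sigma2 * _ in p *; set e := (c i * d i)^-1.
  have e0 : 0 <= e by exact: ltW (b0 i).
  set b := \sum_(j | j != i) (c j * d j)^-1 * tnth v j ^+ 2 + sqnorm (colv u) / gamma.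
  have b_ge0 : 0 <= b.
    rewrite addr_ge0 ?(sqn_ge0 (v, u))//; apply: sumr_ge0 => j _.
    by rewrite mulr_ge0 ?sqr_ge0// ltW.
  have -> : (fun t : R => shrink (qW (upd v i t, u)) s -
      2 * shrink (qW (upd v i t, u)) s ^+ 2 * (e * tnth (upd v i t) i ^+ 2) / (nu * s)) =
      (fun t : R => nu * (nu + 1 + (e * t ^+ 2 + b) / s)^-1 -
        2 * (nu * (nu + 1 + (e * t ^+ 2 + b) / s)^-1) ^+ 2 * (e * t ^+ 2) / (nu * s)).
    by apply/funext => t; rewrite qW_upd tnth_upd eqxx.
  have den : nu + 1 + (e * y ^+ 2 + b) / s != 0.
    rewrite gt_eqF//; have : 0 <= (e * y ^+ 2 + b) / s.
      by apply: divr_ge0; [apply: addr_ge0 => //; apply: mulr_ge0 => //; exact: sqr_ge0|exact: ltW].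
    by move: nu0; lra.
  have c1 : {for y, continuous (fun t : R => e * t ^+ 2)}.
    by apply: cvgM; [exact: cvg_cst|exact: exprn_continuous].
  have c2 : {for y, continuous (fun t : R => nu * (nu + 1 + (e * t ^+ 2 + b) / s)^-1)}.
    apply: cvgM; first exact: cvg_cst.
    apply: cvgV => //; apply: cvgD; first exact: cvg_cst.
    apply: cvgM; last exact: cvg_cst.
    by apply: cvgD; [exact: c1|exact: cvg_cst].
  apply: cvgB; first exact: c2.
  apply: cvgM; last exact: cvg_cst.
  apply: cvgM; last exact: c1.
  apply: cvgM; first exact: cvg_cst.
  exact: (cvg_comp _ _ c2 (@exprn_continuous _ 2 _)).
have mV := measurable_shrinkV i; have mV' := measurable_shrinkV' i.
rewrite -s2; split.
- exact: (integrable_stein_product1 theta kappa Z s0 mV fK).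
- exact: (integrable_stein_product2 theta (fun i => Num.sqrt (sigma2 * d i)) i
    kappa Z mV' f'K).
- exact: (stein_product theta kappa Z s0 mV mV' fK f'K df cf').
Qed.

(* On [s > 0], [shrinkS y s] is [shrink (qW y) s] and [shrinkA y s] is
   [shrink (qW y) s ^+ 2 * (qA y / s)]; unlike these quotients, they are
   differentiable at [s = 0], also when [qW y = 0]. The versions with a [d] are
   the derivatives in [s]. *)
Definition shrinkS (y : Y) (s : R) : R :=
  nu / (nu + 1) * (1 - qW y / ((nu + 1) * s + qW y)).

Definition dshrinkS (y : Y) (s : R) : R := nu * qW y / ((nu + 1) * s + qW y) ^+ 2.

Definition shrinkA (y : Y) (s : R) : R :=
  nu ^+ 2 * qA y * (s / ((nu + 1) * s + qW y) ^+ 2).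

Definition dshrinkA (y : Y) (s : R) : R :=
  nu ^+ 2 * qA y * ((qW y - (nu + 1) * s) / ((nu + 1) * s + qW y) ^+ 3).

Let mqW : measurable_fun setT (fun p : Y * R => qW p.1).
Proof. by apply: (measurableT_comp measurable_qW). Qed.

Let mqA : measurable_fun setT (fun p : Y * R => qA p.1).
Proof. by apply: (measurableT_comp measurable_qA). Qed.

Let mden : measurable_fun setT (fun p : Y * R => (nu + 1) * p.2 + qW p.1).
Proof. by apply: measurable_funD => //; apply: measurable_funM. Qed.

Lemma same_mean_shrinkS : same_mean M
  (fun w => sqnorm (colv w.2) * shrinkS w.1 (sigma2 * sqnorm (colv w.2)))
  (fun w => N%:R * shrinkS w.1 (sigma2 * sqnorm (colv w.2)) +
    2 * (sigma2 * sqnorm (colv w.2) * dshrinkS w.1 (sigma2 * sqnorm (colv w.2)))).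
Proof.
have n1 : 0 < nu + 1 by move: nu0; lra.
have mg : measurable_fun setT (fun p : Y * R => shrinkS p.1 p.2).
  apply: measurable_funM => //; apply: measurable_funB => //; apply: measurable_funM => //.
  exact: measurable_funV.
have mg' : measurable_fun setT (fun p : Y * R => dshrinkS p.1 p.2).
  apply: measurable_funM; first exact: measurable_funM.
  by apply: measurable_funV; apply: measurable_funX.
have dg y (s : R) : 0 <= s -> is_derive s 1 (shrinkS y) (dshrinkS y s).
  (* If [qW y = 0], the quotient is 0 whatever its denominator and the function is constant in s;
     otherwise the denominator is positive for every s >= 0. *)
  move=> s0; rewrite /shrinkS /dshrinkS; have := qW_ge0 y; rewrite le_eqVlt => /predU1P[<-|w0].
    under eq_fun do rewrite mul0r subr0 mulr1.
    by rewrite mulr0 mul0r; exact: is_derive_cst.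
  have den : 0 < (nu + 1) * s + qW y by rewrite ltr_wpDl// mulr_ge0// ltW.
  have dV : is_derive s (1 : R) (fun s : R => ((nu + 1) * s + qW y)^-1)
      (- ((nu + 1) * s + qW y) ^- 2 * (nu + 1)).
    apply: is_derive_eq; first by apply: is_deriveV; rewrite gt_eqF.
    by rewrite /GRing.scale/=; field; rewrite gt_eqF.
  apply: is_derive_eq.
  by rewrite /GRing.scale/=; field; rewrite !gt_eqF.
have cg' y (s : R) : 0 <= s -> {for s, continuous (dshrinkS y)}.
  move=> s0; have := qW_ge0 y; rewrite le_eqVlt => /predU1P[w0|w0].
    have -> : dshrinkS y = cst 0 by apply/funext => t; rewrite /dshrinkS -w0 mulr0 mul0r.
    exact: cst_continuous.
  have den : 0 < (nu + 1) * s + qW y by rewrite ltr_wpDl// mulr_ge0// ltW.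
  have c1 : {for s, continuous (fun s : R => (nu + 1) * s + qW y)}.
    apply: cvgD; last exact: cvg_cst.
    by apply: cvgM; [exact: cvg_cst|exact: cvg_id].
  apply: cvgM; first exact: cvg_cst.
  apply: cvgV; first by rewrite expf_neq0// gt_eqF.
  exact: (cvg_comp _ _ c1 (@exprn_continuous _ 2 _)).
have gK y s : 0 <= s -> `|shrinkS y s| <= 1.
  move=> s0; rewrite /shrinkS; have w0 := qW_ge0 y.
  have h1 : 0 <= qW y / ((nu + 1) * s + qW y).
    by rewrite divr_ge0// addr_ge0// mulr_ge0// ltW.
  have h2 : qW y / ((nu + 1) * s + qW y) <= 1.
    move: w0; rewrite le_eqVlt => /predU1P[<-|w0]; first by rewrite mul0r.
    have den : 0 < (nu + 1) * s + qW y by rewrite ltr_wpDl// mulr_ge0// ltW.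
    by rewrite ler_pdivrMr// mul1r lerDr mulr_ge0// ltW.
  have h3 : 0 <= nu / (nu + 1) by rewrite divr_ge0// ltW.
  have h4 : nu / (nu + 1) <= 1 by rewrite ler_pdivrMr// mul1r lerDl.
  rewrite ger0_norm; last by rewrite mulr_ge0// subr_ge0.
  by rewrite mulr_ile1//; [rewrite subr_ge0|rewrite lerBlDr lerDl].
have g'K y s : 0 <= s -> `|s * dshrinkS y s| <= 1.
  move=> s0; rewrite /dshrinkS; have := qW_ge0 y; rewrite le_eqVlt => /predU1P[<-|w0].
    by rewrite mulr0 mul0r mulr0 normr0.
  have den : 0 < (nu + 1) * s + qW y by rewrite ltr_wpDl// mulr_ge0// ltW.
  have n0 := ltW nu0.
  rewrite ger0_norm; last first.
    by rewrite mulr_ge0// divr_ge0 ?sqr_ge0// mulr_ge0// ltW.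
  rewrite mulrA ler_pdivrMr ?exprn_gt0// mul1r.
  have h1 : 0 <= s * qW y by rewrite mulr_ge0// ltW.
  have h2 : 0 <= nu * (s * qW y) by rewrite mulr_ge0.
  have q1 := sqr_ge0 ((nu + 1) * s); have q2 := sqr_ge0 (qW y).
  rewrite [leRHS](_ : _ = ((nu + 1) * s) ^+ 2 + qW y ^+ 2 +
      2 * (nu * (s * qW y)) + 2 * (s * qW y)); last by ring.
  rewrite [leLHS](_ : _ = nu * (s * qW y)); last by ring.
  lra.
split.
- exact: (integrable_chi1 N sigma20 M1 mg gK).
- exact: (integrable_chi2 N sigma20 M1 mg mg' gK g'K).
- exact: (chi_product N sigma20 M1 mg mg' dg cg' gK g'K).
Qed.

Lemma same_mean_shrinkA : same_mean M
  (fun w => sqnorm (colv w.2) * shrinkA w.1 (sigma2 * sqnorm (colv w.2)))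
  (fun w => N%:R * shrinkA w.1 (sigma2 * sqnorm (colv w.2)) +
    2 * (sigma2 * sqnorm (colv w.2) * dshrinkA w.1 (sigma2 * sqnorm (colv w.2)))).
Proof.
have n1 : 0 < nu + 1 by move: nu0; lra.
(* In the degenerate case [qW y = 0] this makes [shrinkA] vanish identically, so that nothing
   singular is left at s = 0. *)
have qA_eq0 y : qW y = 0 -> qA y = 0.
  move=> w0; apply/eqP; rewrite eq_le qA_ge0 andbT.
  by have := qA_le y; rewrite w0 mulr0.
have mg : measurable_fun setT (fun p : Y * R => shrinkA p.1 p.2).
  apply: measurable_funM; first exact: measurable_funM.
  by apply: measurable_funM => //; apply: measurable_funV; apply: measurable_funX.
have mg' : measurable_fun setT (fun p : Y * R => dshrinkA p.1 p.2).
  apply: measurable_funM; first exact: measurable_funM.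
  apply: measurable_funM; last by apply: measurable_funV; apply: measurable_funX.
  by apply: measurable_funB => //; apply: measurable_funM.
have dg y (s : R) : 0 <= s -> is_derive s 1 (shrinkA y) (dshrinkA y s).
  move=> s0; rewrite /shrinkA /dshrinkA; have := qW_ge0 y; rewrite le_eqVlt => /predU1P[w0|w0].
    rewrite qA_eq0//; under eq_fun do rewrite mulr0 mul0r.
    by rewrite mulr0 mul0r; exact: is_derive_cst.
  have den : 0 < (nu + 1) * s + qW y by rewrite ltr_wpDl// mulr_ge0// ltW.
  have dV : is_derive s (1 : R) (fun s : R => (((nu + 1) * s + qW y) ^+ 2)^-1)
      (- 2 * (nu + 1) / ((nu + 1) * s + qW y) ^+ 3).
    apply: is_derive_eq; first by apply: is_deriveV; rewrite expf_neq0// gt_eqF.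
    by rewrite /GRing.scale/=; field; rewrite gt_eqF.
  apply: is_derive_eq.
  by rewrite /GRing.scale/=; field; rewrite !gt_eqF.
have cg' y (s : R) : 0 <= s -> {for s, continuous (dshrinkA y)}.
  move=> s0; have := qW_ge0 y; rewrite le_eqVlt => /predU1P[w0|w0].
    have -> : dshrinkA y = cst 0.
      by apply/funext => t; rewrite /dshrinkA qA_eq0// mulr0 mul0r.
    exact: cst_continuous.
  have den : 0 < (nu + 1) * s + qW y by rewrite ltr_wpDl// mulr_ge0// ltW.
  have c0s : {for s, continuous (fun s : R => (nu + 1) * s)}.
    by apply: cvgM; [exact: cvg_cst|exact: cvg_id].
  have c1 : {for s, continuous (fun s : R => (nu + 1) * s + qW y)}.
    by apply: cvgD; [exact: c0s|exact: cvg_cst].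
  apply: cvgM; first exact: cvg_cst.
  apply: cvgM; first by apply: cvgB; [exact: cvg_cst|exact: c0s].
  apply: cvgV; first by rewrite expf_neq0// gt_eqF.
  exact: (cvg_comp _ _ c1 (@exprn_continuous _ 3 _)).
(* The bound nu rmax results from a <= rmax w and nu s w <= ((nu + 1) s + w)^2. *)
have aux (s w a : R) : 0 <= s -> 0 < w -> 0 <= a -> a <= rmax * w ->
    nu ^+ 2 * a * (s / ((nu + 1) * s + w) ^+ 2) <= nu * rmax.
  move=> s0 w0 a0 aw.
  have den : 0 < (nu + 1) * s + w by rewrite ltr_wpDl// mulr_ge0// ltW.
  have n0 := nu0; have r0 := rmax0.
  rewrite mulrA ler_pdivrMr ?exprn_gt0//.
  apply: (@le_trans _ _ (nu ^+ 2 * (rmax * w) * s)).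
    by rewrite ler_wpM2r// ler_wpM2l ?sqr_ge0.
  rewrite (_ : nu ^+ 2 * _ * s = nu * rmax * (nu * (s * w))); last by ring.
  rewrite ler_pM2l ?mulr_gt0//.
  have h1 : 0 <= s * w by rewrite mulr_ge0// ltW.
  have h2 : 0 <= nu * (s * w) by rewrite mulr_ge0// ltW.
  have q1 := sqr_ge0 ((nu + 1) * s); have q2 := sqr_ge0 w.
  rewrite [leRHS](_ : _ = ((nu + 1) * s) ^+ 2 + w ^+ 2 +
      2 * (nu * (s * w)) + 2 * (s * w)); last by ring.
  lra.
have gK y s : 0 <= s -> `|shrinkA y s| <= nu * rmax.
  move=> s0; rewrite /shrinkA; have := qW_ge0 y; rewrite le_eqVlt => /predU1P[w0|w0].
    by rewrite qA_eq0// mulr0 mul0r normr0 ltW// mulr_gt0.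
  rewrite ger0_norm; last first.
    apply: mulr_ge0; last by rewrite divr_ge0 ?sqr_ge0.
    by apply: mulr_ge0; [exact: sqr_ge0|exact: qA_ge0].
  by apply: aux => //; [exact: qA_ge0|exact: qA_le].
have g'K y s : 0 <= s -> `|s * dshrinkA y s| <= nu * rmax.
  move=> s0; rewrite /dshrinkA; have := qW_ge0 y; rewrite le_eqVlt => /predU1P[w0|w0].
    by rewrite qA_eq0// mulr0 mul0r mulr0 normr0 ltW// mulr_gt0.
  have den : 0 < (nu + 1) * s + qW y by rewrite ltr_wpDl// mulr_ge0// ltW.
  (* The derivative times s is the function itself times a ratio of absolute value at most 1, so the
     same bound serves again. *)
  rewrite (_ : s * _ = nu ^+ 2 * qA y * (s / ((nu + 1) * s + qW y) ^+ 2) *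
    ((qW y - (nu + 1) * s) / ((nu + 1) * s + qW y))); last by field; rewrite gt_eqF.
  rewrite normrM -[leRHS]mulr1 ler_pM//.
    rewrite ger0_norm; last first.
      apply: mulr_ge0; last by rewrite divr_ge0 ?sqr_ge0.
    by apply: mulr_ge0; [exact: sqr_ge0|exact: qA_ge0].
    by apply: aux => //; [exact: qA_ge0|exact: qA_le].
  have h : 0 <= (nu + 1) * s by rewrite mulr_ge0// ltW.
  rewrite normrM normfV [X in _ / X]ger0_norm ?(ltW den)// ler_pdivrMr// mul1r.
  by rewrite ler_norml; lra.
split.
- exact: (integrable_chi1 N sigma20 M1 mg gK).
- exact: (integrable_chi2 N sigma20 M1 mg mg' gK g'K).
- exact: (chi_product N sigma20 M1 mg mg' dg cg' gK g'K).
Qed.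

End shrinkage.

(** * Sign of the mean loss difference *)

Lemma integrable_ae_eq d (T : measurableType d) (R : realType)
    (P : {measure set T -> \bar R}) (f g : T -> R) :
  measurable_fun setT g -> {ae P, forall x, f x = g x} ->
  P.-integrable setT (EFin \o f) -> P.-integrable setT (EFin \o g).
Proof.
move=> mg fg /integrableP[mf foo]; apply/integrableP; split.
  exact/measurable_EFinP.
have -> // : (\int[P]_x `|(EFin \o g) x| = \int[P]_x `|(EFin \o f) x|)%E.
apply: ae_eq_integral => //.
- by apply: measurableT_comp => //; exact/measurable_EFinP.
- exact: measurableT_comp.
- by apply: filterS fg => x fgx _ /=; rewrite fgx.
Qed.

(** The vector z vanishes only if its first coordinate does, and the law of that coordinate has no
    atom. *)
Lemma ae_sqnorm_gt0 (R : realType) d (T : measurableType d) (N : nat)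
    (kappa : probability T R) : (0 < N)%N ->
  {ae (kappa \x @gauss R N (fun=> 0%R) (fun=> 1%R))%E,
    forall w, 0 < sqnorm (colv w.2)}.
Proof.
case: N => // N _; set Z := gauss _ _; set M := (kappa \x Z)%E.
pose A : set (N.+1.-tuple R) := [set z | tnth z ord0 = 0].
have mA : measurable A.
  have := @measurable_coord R N.+1 ord0 measurableT [set 0] (measurable_set1 _).
  by rewrite setTI.
exists (snd @^-1` A); split.
- by rewrite -[X in measurable X]setTI; exact: measurable_snd.
- apply: (eq_trans (law_snd kappa Z mA)).
  have := @gauss_tnth R N.+1 (fun=> 0) (fun=> 1) ord0 [set 0] (measurable_set1 _).
  move=> ->; have /null_content_dominatesP := @normal_prob_dominates R 0 1; apply.
    exact: measurable_set1.
  exact: lebesgue_measure_set1.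
- move=> w /=; apply: contra_notP => wA.
  rewrite sqnorm_colv (bigD1 ord0)//= ltr_pwDl//.
    by rewrite exprn_even_gt0//=; apply/eqP.
  by apply: sumr_ge0 => i _; exact: sqr_ge0.
Qed.

(** If the integral were nonnegative, the integral of |f|, its opposite, would be 0; then f = 0
    almost everywhere, which a measure of total mass 1 forbids. *)
Lemma integral_ae_lt0 d (T : measurableType d) (R : realType)
    (P : probability T R) (f : T -> R) :
  {ae P, forall x, f x < 0} -> P.-integrable setT (EFin \o f) ->
  (\int[P]_x (f x)%:E < 0)%E.
Proof.
move=> f0 intf; have mf := measurable_int _ intf.
have fE : (\int[P]_x `|(f x)%:E| = - \int[P]_x (f x)%:E)%E.
  rewrite -integralN; last first.
    exact: integrable_add_def.
  apply: ae_eq_integral => //; first exact: measurableT_comp.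
    exact: measurableT_comp.
  by apply: filterS f0 => x fx0 _ /=; rewrite ler0_norm// ltW.
rewrite ltNge; apply/negP => I0.
have : (\int[P]_x `|(f x)%:E| = 0)%E.
  apply/eqP; rewrite eq_le integral_ge0// andbT fE.
  by rewrite leeNl oppe0.
move/(ae_eq_integral_abs P measurableT mf) => fae.
have [A [mA PA sA]] : {ae P, forall x : T, False}.
  by apply: filterS2 f0 fae => x fx0 /(_ I) /= [fx]; rewrite fx ltxx in fx0.
have : (P setT <= P A)%E by apply: le_measure; rewrite ?inE// => x _; apply: sA.
by rewrite PA probability_setT lee_fin ler10.
Qed.

Section risk_difference.
Context (R : realType) (l q N : nat).
Variables (c d : 'I_l -> R) (gamma nu sigma2 m rmax : R) (theta : 'I_l -> R)
  (kappa : probability (q.-tuple R) R).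
Hypotheses (c0 : forall i, 0 < c i) (d0 : forall i, 0 < d i) (gamma0 : 0 < gamma)
  (nu0 : 0 < nu) (sigma20 : 0 < sigma2) (N0 : (0 < N)%N) (m0 : 0 < m)
  (rmax_ge : forall i, d i / c i <= rmax) (rmax0 : 0 < rmax)
  (rmax_le : rmax <= \sum_i d i / c i).
Hypothesis nu_le1 : nu * (2 * rmax * (N%:R + 2) + m) <=
  4 * (\sum_i d i / c i - 2 * rmax + m / N%:R).
Hypothesis nu_le3 : nu * m <= 4 * \sum_i d i / c i.

Local Notation G := (gauss theta (fun i => Num.sqrt (sigma2 * d i))).
Local Notation Z := (@gauss R N (fun=> 0) (fun=> 1)).
Local Notation M := (G \x kappa \x Z)%E.
Local Notation W y := (qW c d gamma y).
Local Notation S w := (sigma2 * sqnorm (colv w.2)).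
Local Notation phi w := (shrink nu (W w.1) (S w)).
Local Notation gS y s := (shrinkS c d gamma nu y s).
Local Notation gA y s := (shrinkA c d gamma nu y s).
Local Notation dgS y s := (dshrinkS c d gamma nu y s).
Local Notation dgA y s := (dshrinkA c d gamma nu y s).
Local Notation T := ((l.-tuple R * q.-tuple R) * N.-tuple R)%type.

(* Twice the difference of the losses, when [S w > 0]. *)
Definition loss_diff (w : T) : R :=
  - (2 / sigma2) * (\sum_i (c i)^-1 *
      ((tnth w.1.1 i - theta i) * shrinkV c d gamma nu sigma2 i w))
  + sqnorm (colv w.2) * gA w.1 (S w)
  + - (m / N%:R) * (sqnorm (colv w.2) * gS w.1 (S w))
  + - m * ln (1 - phi w).

(* Same mean as [loss_diff], but a function of the data only. *)
Definition unbiased_diff (w : T) : R :=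
  - (2 / sigma2) * (\sum_i (c i)^-1 *
      (sigma2 * d i * shrinkV' c d gamma nu sigma2 i w))
  + (N%:R * gA w.1 (S w) + 2 * (S w * dgA w.1 (S w)))
  + - (m / N%:R) * (N%:R * gS w.1 (S w) + 2 * (S w * dgS w.1 (S w)))
  + - m * ln (1 - phi w).

Let phi_gt0 (w : T) : 0 < phi w.
Proof. by apply: shrink_gt0 => //; [exact: qW_ge0|exact: ssq_ge0]. Qed.

Let phi_le (w : T) : phi w <= nu / (nu + 1).
Proof. by apply: shrink_le => //; [exact: qW_ge0|exact: ssq_ge0]. Qed.

Lemma measurable_ln_shrink : measurable_fun setT (fun w : T => ln (1 - phi w)).
Proof.
apply: measurableT_comp => //; apply: measurable_funB => //.
apply: measurable_shrink => //; apply: measurable_funM => //.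
exact: (measurableT_comp (@measurable_sqnorm R N) measurable_snd).
Qed.

(** The values 1 - phi lie between 1 / (nu + 1) and 1, so the logarithm is bounded and can stay
    unchanged in both forms of the difference. *)
Lemma integrable_ln_shrink : M.-integrable setT (EFin \o (fun w => ln (1 - phi w))).
Proof.
have n0 := nu0; have n1 : 0 < nu + 1 by lra.
apply: (@integrable_bounded _ _ _ M _ (ln (nu + 1))).
  exact: measurable_ln_shrink.
move=> w; have p0 := phi_gt0 w; have := phi_le w.
rewrite (_ : nu / (nu + 1) = 1 - (nu + 1)^-1); last by field; rewrite gt_eqF.
have i0 : 0 < (nu + 1)^-1 by rewrite invr_gt0.
move=> ple; have h1 : (nu + 1)^-1 <= 1 - phi w by lra.
have h2 : ln (1 - phi w) <= 0 by apply: ln_le0; lra.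
rewrite ler0_norm// lerNl -lnV ?posrE// ler_ln ?posrE//; lra.
Qed.

Lemma same_mean_diff : same_mean M loss_diff unbiased_diff.
Proof.
apply: same_mean_add; last first.
  by apply: same_mean_scale; apply: same_mean_refl; exact: integrable_ln_shrink.
apply: same_mean_add; last first.
  by apply: same_mean_scale; exact: same_mean_shrinkS.
apply: same_mean_add; last exact: same_mean_shrinkA rmax_ge rmax0.
apply: same_mean_scale; apply: same_mean_sum => i; apply: same_mean_scale.
exact: same_mean_shrinkV.
Qed.

Lemma unbiased_diff_lt0 w : 0 < sqnorm (colv w.2) -> unbiased_diff w < 0.
Proof.
move=> z0; have s0 : 0 < S w by rewrite mulr_gt0.
have NR0 : 0 < N%:R :> R by rewrite ltr0n.
have W0 : 0 <= W w.1 by exact: qW_ge0.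
have A0 : 0 <= qA c w.1 by exact: qA_ge0.
have AW : qA c w.1 <= rmax * W w.1 by exact: qA_le.
have n0 := nu0; have n1 : 0 < nu + 1 by lra.
pose s := S w; rewrite -/s in s0.
have den : 0 < (nu + 1) * s + W w.1 by rewrite ltr_pwDl// mulr_gt0.
have denE : nu + 1 + W w.1 / s = ((nu + 1) * s + W w.1) / s.
  by field; rewrite gt_eqF.
have := @improvement_lt0 R nu (W w.1 / s) (qA c w.1 / s) (\sum_i d i / c i)
  rmax N%:R m nu0 _ _ _ rmax0 rmax_le NR0 m0 nu_le1 nu_le3 (phi w) erefl.
have -> : unbiased_diff w =
  - 2 * (phi w * (\sum_i d i / c i) - 2 * phi w ^+ 2 * (qA c w.1 / s) / nu) +
  N%:R * (phi w ^+ 2 * (qA c w.1 / s)) +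
  2 * (- (phi w ^+ 2 * (qA c w.1 / s)) +
       2 * (qA c w.1 / s) * (W w.1 / s) * phi w ^+ 3 / nu) -
  m / N%:R * (N%:R * phi w + 2 * (W w.1 / s * phi w ^+ 2 / nu)) - m * ln (1 - phi w).
  rewrite /unbiased_diff -/s.
  have -> : \sum_i (c i)^-1 * (sigma2 * d i * shrinkV' c d gamma nu sigma2 i w) =
    sigma2 * (phi w * (\sum_i d i / c i) - 2 * phi w ^+ 2 * (qA c w.1 / s) / nu).
    transitivity (\sum_i (c i)^-1 * (sigma2 * d i * (phi w -
        2 * phi w ^+ 2 * ((c i * d i)^-1 * tnth w.1.1 i ^+ 2) / (nu * s)))).
      by apply: eq_bigr => i _; rewrite /shrinkV' -/s s0.
    move: (phi w) => p.
    rewrite /qA mulr_suml !mulr_sumr mulr_suml -sumrB mulr_sumr.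
    by apply: eq_bigr => i _; field; rewrite !gt_eqF.
  (* For s > 0 the extensions become phi and phi^2 A again. The s-derivatives, times s, follow from
     W and A being proportional to 1 / s: that of phi gives W phi^2 / nu. *)
  have e1 : gS w.1 s = phi w.
    by rewrite /shrinkS /shrink -/s denE; field; rewrite !gt_eqF.
  have e1' : s * dgS w.1 s = W w.1 / s * phi w ^+ 2 / nu.
    by rewrite /dshrinkS /shrink -/s denE; field; rewrite !gt_eqF.
  have e2 : gA w.1 s = phi w ^+ 2 * (qA c w.1 / s).
    by rewrite /shrinkA /shrink -/s denE; field; rewrite !gt_eqF.
  have e2' : s * dgA w.1 s = - (phi w ^+ 2 * (qA c w.1 / s)) +
       2 * (qA c w.1 / s) * (W w.1 / s) * phi w ^+ 3 / nu.
    by rewrite /dshrinkA /shrink -/s denE; field; rewrite !gt_eqF.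
  rewrite e1 e1' e2 e2'; field.
  by rewrite !gt_eqF.
apply.
- by rewrite divr_ge0// ltW.
- by rewrite divr_ge0// ltW.
- by rewrite mulrA ler_pM2r// invr_gt0.
Qed.

Lemma integral_loss_diff_lt0 : (\int[M]_w (loss_diff w)%:E < 0)%E.
Proof.
have [_ int_u ->] := same_mean_diff; apply: integral_ae_lt0 => //.
have := @ae_sqnorm_gt0 R _ _ N (G \x kappa)%E N0.
by apply: filterS => w; exact: unbiased_diff_lt0.
Qed.

End risk_difference.

(** * The two losses as functions of the data *)

Section losses.
Context (R : realType) (l q m N : nat).
Variables (c d : 'I_l -> R) (gamma nu sigma2 : R) (theta : 'cV[R]_l) (mu : 'cV[R]_q).
Hypotheses (c0 : forall i, 0 < c i) (d0 : forall i, 0 < d i).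
Local Notation p := ((theta, mu, sigma2) : param R l q).
Local Notation data := ((l.-tuple R * q.-tuple R) * R)%type.

Definition data_loss (delta : estimator R l q) (x : data) : R :=
  loss m p (delta (colv x.1.1) (colv x.1.2) x.2).

Lemma umvu_lossE (x : data) : data_loss (@umvu R l q N) x =
  2^-1 * ((\sum_i (tnth x.1.1 i - theta i 0) ^+ 2) / sigma2 +
    m%:R * (x.2 / N%:R / sigma2 - ln (x.2 / N%:R / sigma2) - 1)).
Proof.
rewrite /data_loss /loss /umvu /=; congr (_ * (_ / _ + _)).
by apply: eq_bigr => i _; rewrite !mxE.
Qed.

Lemma WstatE (x : data) :
  Wstat (diag_mx (\row_i c i)) (diag_mx (\row_i d i)) gamma
    (colv x.1.1) (colv x.1.2) x.2 = qW c d gamma x.1 / x.2.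
Proof.
rewrite /Wstat /qW; congr ((_ + _) / _).
rewrite !invmx_diag; [|by move=> i; rewrite gt_eqF..].
rewrite -(mulmxA (_^T)) mulmx_diag.
rewrite (_ : \row__ _ = \row_i (c i * d i)^-1); last first.
  by apply/rowP => i; rewrite !mxE invfM.
by rewrite quad_diag; apply: eq_bigr => i _; rewrite mxE.
Qed.

Lemma gbayes_lossE (x : data) :
  data_loss (@gbayes R l q N (diag_mx (\row_i c i)) (diag_mx (\row_i d i)) gamma nu) x =
  let phi := shrink nu (qW c d gamma x.1) x.2 in
  2^-1 * ((\sum_i (tnth x.1.1 i - phi * ((c i)^-1 * tnth x.1.1 i) - theta i 0) ^+ 2) / sigma2 +
    m%:R * ((1 - phi) * (x.2 / N%:R) / sigma2 -
            ln ((1 - phi) * (x.2 / N%:R) / sigma2) - 1)).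
Proof.
rewrite /data_loss /loss /gbayes /= WstatE -/(shrink _ _ _).
set phi := shrink _ _ _; congr (_ * (_ / _ + _)).
apply: eq_bigr => i _; congr (_ ^+ 2).
rewrite mulmxBl mul1mx -scalemxAl invmx_diag; last by move=> j; rewrite gt_eqF.
by rewrite mul_diag_mx !mxE.
Qed.

Let mv i : measurable_fun setT (fun x : data => tnth x.1.1 i).
Proof.
apply: (measurableT_comp (measurable_tnth i)).
exact: (measurableT_comp measurable_fst measurable_fst).
Qed.

Lemma measurable_umvu_loss : measurable_fun setT (data_loss (@umvu R l q N)).
Proof.
rewrite (funext umvu_lossE).
apply: measurable_funM => //; apply: measurable_funD.
  apply: measurable_funM => //; apply: measurable_sum => i.
  by apply: measurable_funX; apply: measurable_funB.
have mS : measurable_fun setT (fun x : data => x.2 / N%:R / sigma2).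
  by apply: measurable_funM => //; apply: measurable_funM.
apply: measurable_funM => //; apply: measurable_funB => //.
by apply: measurable_funB => //; exact: measurableT_comp.
Qed.

Lemma measurable_gbayes_loss : measurable_fun setT (data_loss
  (@gbayes R l q N (diag_mx (\row_i c i)) (diag_mx (\row_i d i)) gamma nu)).
Proof.
rewrite (funext gbayes_lossE) /=.
have mphi : measurable_fun setT
    (fun x : data => shrink nu (qW c d gamma x.1) x.2).
  exact: measurable_shrink.
apply: measurable_funM => //; apply: measurable_funD.
  apply: measurable_funM => //; apply: measurable_sum => i.
  apply: measurable_funX; apply: measurable_funB => //; apply: measurable_funB => //.
  by apply: measurable_funM => //; apply: measurable_funM.
have mS : measurable_fun setT (fun x : data =>
    (1 - shrink nu (qW c d gamma x.1) x.2) * (x.2 / N%:R) / sigma2).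
  apply: measurable_funM => //; apply: measurable_funM; last exact: measurable_funM.
  exact: measurable_funB.
apply: measurable_funM => //; apply: measurable_funB => //.
by apply: measurable_funB => //; exact: measurableT_comp.
Qed.

Hypotheses (gamma0 : 0 < gamma) (nu0 : 0 < nu) (sigma20 : 0 < sigma2) (N0 : (0 < N)%N).
Variable kappa : probability (q.-tuple R) R.
Local Notation G := (gauss (fun i => theta i 0) (fun i => Num.sqrt (sigma2 * d i))).
Local Notation Z := (@gauss R N (fun=> 0) (fun=> 1)).
Local Notation M := (G \x kappa \x Z)%E.

(** Expand the square and split ln ((1 - phi) S / (N sigma^2)). The split needs S > 0, and at S = 0
    [shrinkV] is cut off. *)
Lemma gbayes_loss_diff (w : (l.-tuple R * q.-tuple R) * N.-tuple R) :
  0 < sqnorm (colv w.2) ->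
  data_loss (@gbayes R l q N (diag_mx (\row_i c i)) (diag_mx (\row_i d i)) gamma nu)
    (canon_data sigma2 w) =
  data_loss (@umvu R l q N) (canon_data sigma2 w) +
  2^-1 * loss_diff c d gamma nu sigma2 m%:R (fun i => theta i 0) w.
Proof.
move=> z0; have s0 : 0 < sigma2 * sqnorm (colv w.2) by rewrite mulr_gt0.
have NR0 : 0 < N%:R :> R by rewrite ltr0n.
rewrite gbayes_lossE umvu_lossE /loss_diff /canon_data /=.
set z := sqnorm (colv w.2) in z0 s0 *.
set s := sigma2 * z.
have W0 : 0 <= qW c d gamma w.1 by exact: qW_ge0.
have phi0 := shrink_gt0 nu0 W0 (ltW s0).
have phi1 := shrink_lt1 nu0 W0 (ltW s0).
have e1 : shrinkS c d gamma nu w.1 s = shrink nu (qW c d gamma w.1) s.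
  have den : 0 < (nu + 1) * s + qW c d gamma w.1.
    by rewrite ltr_pwDl// mulr_gt0//; move: nu0; lra.
  have n1 : nu + 1 != 0 by rewrite gt_eqF//; move: nu0; lra.
  have denE : nu + 1 + qW c d gamma w.1 / s = ((nu + 1) * s + qW c d gamma w.1) / s.
    by field; rewrite gt_eqF.
  by rewrite /shrinkS /shrink denE; field; rewrite n1 !gt_eqF.
have e2 : z * shrinkA c d gamma nu w.1 s =
    shrink nu (qW c d gamma w.1) s ^+ 2 * qA c w.1 / sigma2.
  have den : 0 < (nu + 1) * s + qW c d gamma w.1.
    by rewrite ltr_pwDl// mulr_gt0//; move: nu0; lra.
  have denE : nu + 1 + qW c d gamma w.1 / s = ((nu + 1) * s + qW c d gamma w.1) / s.
    by field; rewrite gt_eqF.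
  rewrite /shrinkA /shrink denE (_ : z = s / sigma2); last by rewrite /s; field; rewrite gt_eqF.
  by field; rewrite !gt_eqF.
have eV i : shrinkV c d gamma nu sigma2 i w =
    shrink nu (qW c d gamma w.1) s * tnth w.1.1 i.
  by rewrite /shrinkV -/z -/s s0.
rewrite e1 e2.
have -> : \sum_i (c i)^-1 * ((tnth w.1.1 i - theta i 0) *
      shrinkV c d gamma nu sigma2 i w) =
    \sum_i (c i)^-1 * ((tnth w.1.1 i - theta i 0) *
      (shrink nu (qW c d gamma w.1) s * tnth w.1.1 i)).
  by apply: eq_bigr => i _; rewrite eV.
move: (shrink nu _ s) phi0 phi1 => phi phi0 phi1.
have lnE : ln ((1 - phi) * (s / N%:R) / sigma2) = ln (1 - phi) + ln (s / N%:R / sigma2).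
  have q0 : 0 < s / N%:R / sigma2 by exact: divr_gt0 (divr_gt0 s0 NR0) sigma20.
  have p0 : 0 < 1 - phi by rewrite subr_gt0.
  by rewrite -lnM ?posrE// mulrA.
have sumE : \sum_i (tnth w.1.1 i - phi * ((c i)^-1 * tnth w.1.1 i) - theta i 0) ^+ 2 =
    \sum_i (tnth w.1.1 i - theta i 0) ^+ 2
    - 2 * (\sum_i (c i)^-1 * ((tnth w.1.1 i - theta i 0) * (phi * tnth w.1.1 i)))
    + phi ^+ 2 * qA c w.1.
  rewrite /qA !mulr_sumr -sumrB -big_split /=.
  by apply: eq_bigr => i _; ring.
rewrite lnE sumE (_ : z = s / sigma2); last by rewrite /s; field; rewrite gt_eqF.
field.
by rewrite !gt_eqF.
Qed.

(** Once sigma^2 cancels in S / sigma^2, the loss is dominated by second moments of V, by |z|^2 and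
    by |ln (|z|^2)|, using (v - t)^2 <= (1 + |t|)^2 (1 + |v|)^2. *)
Lemma integrable_umvu_loss :
  M.-integrable setT (EFin \o (data_loss (@umvu R l q N) \o canon_data sigma2)).
Proof.
have NR0 : 0 < N%:R :> R by rewrite ltr0n.
have mdata : measurable_fun setT (@canon_data R l q N sigma2).
  exact: measurable_canon_data.
have iV i : M.-integrable setT (EFin \o (fun w => (1 + `|tnth w.1.1 i|) ^+ 2)).
  have s0 : Num.sqrt (sigma2 * d i) != 0 by rewrite gt_eqF// sqrtr_gt0 mulr_gt0.
  exact: (integrable_sqr_product (fun i => theta i 0) kappa Z s0).
have iL : M.-integrable setT (EFin \o (fun w => `|ln (sqnorm (colv w.2))|)).
  apply: (integrable_norm (f := fun w => ln (sqnorm (colv w.2)))).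
  have mq : measurable_fun setT (EFin \o (fun z : N.-tuple R => ln (sqnorm (colv z)))).
    by apply/measurable_EFinP; apply: measurableT_comp => //; exact: measurable_sqnorm.
  have H := integrable_lawP measurable_snd (@law_snd _ _ _ _ _ (G \x kappa)%E Z) mq.
  exact: H.2 (integrable_ln_sqnorm _ N0).
have iS := @integrable_snd_sqnorm R N _ _ (G \x kappa)%E.
apply: (@integrable_le_integrable _ _ _ M _ (fun w =>
  2^-1 / sigma2 * (\sum_i (1 + `|theta i 0|) ^+ 2 * (1 + `|tnth w.1.1 i|) ^+ 2) +
  2^-1 * m%:R * (N%:R^-1 * sqnorm (colv w.2) + `|ln (sqnorm (colv w.2))| +
     (`|ln N%:R| + 1)))).
- exact: (measurableT_comp measurable_umvu_loss mdata).
- move=> w /=; rewrite umvu_lossE /canon_data /=.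
  set z := sqnorm _; have z0 : 0 <= z by exact: sqnorm_ge0.
  have -> : sigma2 * z / N%:R / sigma2 = z / N%:R by field; rewrite !gt_eqF.
  have lnle : `|ln (z / N%:R)| <= `|ln z| + `|ln N%:R|.
    (* At z = 0 the logarithm of the quotient is [ln 0], which is 0 by convention. *)
    have [zle|zgt] := leP z 0.
      have -> : z = 0 by apply/eqP; rewrite eq_le zle.
      by rewrite mul0r ln0// normr0 addr_ge0.
    by rewrite ln_div ?posrE// ler_normB.
  rewrite mulrDr; apply: (le_trans (ler_normD _ _)); apply: lerD.
    rewrite ger0_norm; last first.
      rewrite mulr_ge0// divr_ge0// ?(ltW sigma20)//.
      by apply: sumr_ge0 => i _; exact: sqr_ge0.
    rewrite mulrA [leRHS]mulrAC ler_pM2r ?invr_gt0// ler_pM2l ?invr_gt0//.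
    apply: ler_sum => i _; rewrite -exprMn -real_normK ?num_real//.
    rewrite lerXn2r ?nnegrE ?mulr_ge0 ?addr_ge0//.
    apply: (le_trans (ler_normB _ _)).
    have := mulr_ge0 (normr_ge0 (theta i 0)) (normr_ge0 (tnth w.1.1 i)).
    by rewrite mulrDl !mulrDr !mul1r mulr1; lra.
  have mle : 0 <= 2^-1 * m%:R :> R by rewrite mulr_ge0// invr_ge0.
  rewrite mulrA normrM ger0_norm// ler_wpM2l//.
  have u0 : 0 <= z / N%:R by rewrite divr_ge0.
  rewrite (mulrC N%:R^-1); move: (z / N%:R) u0 lnle => u u0 lnle.
  have h1 := ler_norm (ln u); have := ler_norm (- ln u); rewrite normrN => h2.
  by rewrite ler_norml; lra.
- apply: integrable_add.
    apply: integrable_scale; apply: integrable_bigsum => i.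
    by apply: integrable_scale; exact: iV.
  apply: integrable_scale; apply: integrable_add; last first.
    apply: (@integrable_bounded _ _ _ M _ (`|ln N%:R| + 1)) => // w.
    by rewrite ger0_norm// addr_ge0.
  apply: integrable_add => //.
  by apply: integrable_scale.
Qed.

End losses.

(** * Strict inequality of the risks at every parameter, and domination *)

Lemma max_of_ge (R : realType) l (r : 'I_l -> R) i : r i <= max_of r.
Proof. exact: le_bigmax. Qed.

Lemma max_of_le_sum (R : realType) l (r : 'I_l -> R) : (forall i, 0 <= r i) ->
  max_of r <= \sum_i r i.
Proof.
move=> r0; apply/bigmax_leP; split; first by apply: sumr_ge0.
move=> i _; rewrite (bigD1 i)//= lerDl.
by apply: sumr_ge0.
Qed.

(** Both risks are moved to the explicit product space, where the losses differ almost everywhere by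
    half of [loss_diff], a function of negative mean. *)
Lemma gbayes_risk_lt (R : realType) (l q m N : nat) (d c : 'I_l -> R)
    (disp : measure_display) (T : measurableType disp)
    (V : {mfun T >-> l.-tuple R}) (Vs : {mfun T >-> q.-tuple R})
    (S : {mfun T >-> R}) (P : param R l q -> probability T R)
    (gamma nu : R) (p : param R l q) :
  param_ok p ->
  canonical_model N (diag_mx (\row_i d i)) V Vs S p (P p) ->
  (0 < l)%N -> (0 < m)%N -> (0 < N)%N ->
  (forall i, 0 < d i) -> (forall i, 0 < c i) -> 0 < gamma -> 0 < nu ->
  nu <= nu1 m N (fun i => d i / c i) -> nu <= nu3 m (fun i => d i / c i) ->
  (risk m P V Vs S
     (@gbayes R l q N (diag_mx (\row_i c i)) (diag_mx (\row_i d i)) gamma nu) p <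
   risk m P V Vs S (@umvu R l q N) p)%E.
Proof.
case: p => -[theta mu] sigma2 sigma20 model l0 m0 N0 d0 c0 gamma0 nu0 hnu1 hnu3.
rewrite /param_ok /= in sigma20.
set p := (theta, mu, sigma2) in model *.
pose rmax := max_of (fun i => d i / c i).
have r0 i : 0 < d i / c i by rewrite divr_gt0.
have rmax_ge i : d i / c i <= rmax by exact: (max_of_ge (fun i => d i / c i)).
(* Since l > 0, some ratio exists and the default value 0 of [max_of] is exceeded. *)
have rmax0 : 0 < rmax by exact: lt_le_trans (r0 (Ordinal l0)) (rmax_ge _).
have rmax_le : rmax <= \sum_i d i / c i by apply: max_of_le_sum => i; exact: ltW.
have mR0 : 0 < m%:R :> R by rewrite ltr0n.
have NR0 : 0 < N%:R :> R by rewrite ltr0n.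
have h1 : nu * (2 * rmax * (N%:R + 2) + m%:R) <=
    4 * (\sum_i d i / c i - 2 * rmax + m%:R / N%:R).
  move: hnu1; rewrite /nu1 -/rmax mulrA ler_pdivlMr//.
  by rewrite addr_gt0// !mulr_gt0// addr_gt0.
have h3 : nu * m%:R <= 4 * \sum_i d i / c i.
  by move: hnu3; rewrite /nu3 mulrAC ler_pdivlMr.
pose kappa : probability (q.-tuple R) R := distribution (P p) Vs.
pose M := canon N d Vs (P p) theta sigma2.
pose loss0 := data_loss m sigma2 theta mu (@umvu R l q N).
pose loss1 := data_loss m sigma2 theta mu
  (@gbayes R l q N (diag_mx (\row_i c i)) (diag_mx (\row_i d i)) gamma nu).
pose D := loss_diff c d gamma nu sigma2 m%:R (fun i => theta i 0) :
  (l.-tuple R * q.-tuple R) * N.-tuple R -> R.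
have i0 : M.-integrable setT (EFin \o (loss0 \o canon_data sigma2)).
  exact: integrable_umvu_loss.
have [iD _ _] := same_mean_diff N m%:R (fun i => theta i 0) kappa
  c0 d0 gamma0 nu0 sigma20 rmax_ge rmax0.
have D_lt0 : (\int[M]_w (D w)%:E < 0)%E.
  exact: (integral_loss_diff_lt0 (fun i => theta i 0) kappa c0 d0 gamma0 nu0 sigma20 N0 mR0 rmax_ge rmax0
    rmax_le h1 h3).
have iD2 : M.-integrable setT (EFin \o (fun w => 2^-1 * D w)).
  exact: integrable_scale.
have lossE : {ae M, forall w,
    loss0 (canon_data sigma2 w) + 2^-1 * D w = loss1 (canon_data sigma2 w)}.
  have := @ae_sqnorm_gt0 R _ _ N (canon_VVs d Vs (P p) theta sigma2) N0.
  by apply: filterS => w z0; rewrite -gbayes_loss_diff.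
have m1 : measurable_fun setT loss1 by exact: measurable_gbayes_loss.
have mw : measurable_fun setT (@canon_data R l q N sigma2).
  exact: measurable_canon_data.
(* Integrability of the shrinkage loss is not bounded by hand: it is inherited from the UMVU loss
   and from the difference. *)
have i1 : M.-integrable setT (EFin \o (loss1 \o canon_data sigma2)).
  apply: (integrable_ae_eq _ lossE); first exact: (measurableT_comp m1 mw).
  exact: integrable_add.
have E0 : risk m P V Vs S (@umvu R l q N) p = (\int[M]_w (loss0 (canon_data sigma2 w))%:E)%E.
  rewrite /risk unlock.
  exact: (canonical_integral d0 sigma20 model (measurable_umvu_loss _ _ _ _ _) i0).
have E1 : risk m P V Vs S (@gbayes R l q N (diag_mx (\row_i c i))
    (diag_mx (\row_i d i)) gamma nu) p = (\int[M]_w (loss1 (canon_data sigma2 w))%:E)%E.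
  rewrite /risk unlock.
  exact: (canonical_integral d0 sigma20 model m1 i1).
have E2 : (\int[M]_w (loss1 (canon_data sigma2 w))%:E =
    \int[M]_w (loss0 (canon_data sigma2 w))%:E + 2^-1%:E * \int[M]_w (D w)%:E)%E.
  rewrite -(integralZl measurableT iD) -(integralD_EFin measurableT i0 iD2).
  apply: ae_eq_integral => //.
  - exact: measurable_int i1.
  - by apply: measurable_int; exact: (integrable_add i0 iD2).
  - by apply: filterS lossE => w e _ /=; rewrite -e.
rewrite E0 E1 E2.
(* Finiteness of the UMVU risk is what keeps the inequality strict: a negative real added to an
   infinite risk would not lower it. *)
have f0 : (\int[M]_w (loss0 (canon_data sigma2 w))%:E \is a fin_num)%E.
  exact: (integrable_fin_num measurableT i0).
have fD : (\int[M]_w (D w)%:E \is a fin_num)%E.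
  exact: (integrable_fin_num measurableT iD).
rewrite -(fineK f0) -(fineK fD) -EFinM -EFinD lte_fin gtrDl pmulr_rlt0 ?invr_gt0//.
by rewrite -lte_fin fineK.
Qed.

Theorem theorem4p1 (R : realType) (n k m l : nat)
    (hk : (1 <= k)%N) (hn : (k < n)%N) (hm : (1 <= m)%N) (hl : l = minn k m)
    (d : 'I_l -> R) (hd : forall i j : 'I_l, (i <= j)%N -> d j <= d i)
    (hd0 : forall i, 0 < d i)
    (disp : measure_display) (T : measurableType disp)
    (V : {mfun T >-> l.-tuple R}) (Vs : {mfun T >-> (k - l).-tuple R})
    (S : {mfun T >-> R})
    (P : param R l (k - l) -> probability T R)
    (hP : forall p, param_ok p ->
       canonical_model (n - k) (diag_mx (\row_i d i)) V Vs S p (P p))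
    (c : 'I_l -> R) (hc : forall i, 1 <= c i)
    (gamma : R) (hgamma : 1 <= gamma)
    (nu : R) (hnu0 : 0 < nu)
    (hnu : nu <= Num.min (nu1 m (n - k) (fun i => d i / c i))
                   (Num.min (nu2 m (n - k) (fun i => d i / c i))
                      (nu3 m (fun i => d i / c i)))) :
  dominates (risk m P V Vs S)
    (@gbayes R l (k - l) (n - k) (diag_mx (\row_i c i)) (diag_mx (\row_i d i))
       gamma nu)
    (@umvu R l (k - l) (n - k)).
Proof.
have l0 : (0 < l)%N by rewrite hl leq_min hk.
have N0 : (0 < n - k)%N by rewrite subn_gt0.
move: hnu; rewrite !le_min => /and3P[hnu1 _ hnu3].
have c0 i : 0 < c i by exact: lt_le_trans (hc i).
have gamma0 : 0 < gamma by exact: lt_le_trans hgamma.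
have H p : param_ok p ->
    (risk m P V Vs S (@gbayes R l (k - l) (n - k) (diag_mx (\row_i c i))
       (diag_mx (\row_i d i)) gamma nu) p <
     risk m P V Vs S (@umvu R l (k - l) (n - k)) p)%E.
  by move=> hp; apply: gbayes_risk_lt => //; exact: hP.
split; first by move=> p hp; exact: ltW (H p hp).
(* The inequality is strict at every admissible parameter, so any one is a witness. *)
by exists (0, 0, 1); [|apply: H]; rewrite /param_ok /= ltr01.
Qed.
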